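(* Let $X$ be normal with unknown mean $\mu_X$ and variance $\sigma_X^2>0$, $Y$ normal with unknown mean $\mu_Y$ and variance $\sigma_Y^2>0$, and $\theta=\sigma_X^2/\sigma_Y^2$. Let $X_1,X_2,\dots$ be i.i.d. samples of $X$ and $Y_1,Y_2,\dots$ i.i.d. samples of $Y$, all mutually independent. Let $m\ge2$ and $\delta_0,\dots,\delta_{m-1}\in(0,1)$. Suppose that $\alpha_i=O(\zeta)\in(0,1)$ and $\beta_i=O(\zeta)\in(0,1)$ for $i=1,\dots,m-1$. Let $2\le n_1^X<n_2^X<\dots<n_s^X$ and $2\le n_1^Y<n_2^Y<\dots<n_s^Y$ be the sample sizes for $X$ and $Y$ respectively. For $\ell=1,\dots,s$ and $i=1,\dots,m-1$ define $$u_{\ell,i}=\max\{1,\Upsilon(n_\ell^X-1,n_\ell^Y-1,1-\alpha_i)\},\qquad v_{\ell,i}=\min\{1,\Upsilon(n_\ell^X-1,n_\ell^Y-1,\beta_i)\},$$ $$\hat\theta_\ell=\frac{(n_\ell^Y-1)\sum_{i=1}^{n_\ell^X}(X_i-\overline X_{n_\ell^X})^2}{(n_\ell^X-1)\sum_{i=1}^{n_\ell^Y}(Y_i-\overline Y_{n_\ell^Y})^2},\qquad\overline X_{n_\ell^X}=\frac{\sum_{i=1}^{n_\ell^X}X_i}{n_\ell^X},\quad\overline Y_{n_\ell^Y}=\frac{\sum_{i=1}^{n_\ell^Y}Y_i}{n_\ell^Y}.$$ Suppose that the maximum sample sizes $n_s^X$ and $n_s^Y$ satisfy $\theta_i''v_{s,i}\ge\theta_i'u_{s,i}$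 for $i=1,\dots,m-1$. Define $$f_{\ell,i}=\min\left\{\theta_i''v_{\ell,i},\ \tfrac12(\theta_i'u_{\ell,i}+\theta_i''v_{\ell,i})\right\},\qquad g_{\ell,i}=\max\left\{\theta_i'u_{\ell,i},\ \tfrac12(\theta_i'u_{\ell,i}+\theta_i''v_{\ell,i})\right\}$$ for $i=1,\dots,m-1$ and $\ell=1,\dots,s$, and $$D_\ell=\begin{cases}1&\text{for }\hat\theta_\ell\le f_{\ell,1},\\ i&\text{for }g_{\ell,i-1}<\hat\theta_\ell\le f_{\ell,i}\text{ where }2\le i\le m-1,\\ m&\text{for }\hat\theta_\ell>g_{\ell,m-1},\\0&\text{else}\end{cases}$$ for $\ell=1,\dots,s$. Then $\Pr\{\text{Reject }H_i\mid\theta\}$ is no greater than $\delta_i$ for any $\theta\in\varTheta_i$ and $i=0,1,\dots,m-1$, provided that $\zeta>0$ is sufficiently small.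
   Context: Hypotheses on $\theta\in(0,\infty)$: $H_i:\theta\in\Theta_i$, where $\Theta_0=(0,\theta_1]$, $\Theta_{m-1}=(\theta_{m-1},\infty)$, $\Theta_i=(\theta_i,\theta_{i+1}]$ for $1\le i\le m-2$, with $0<\theta_1<\dots<\theta_{m-1}$. $\varTheta_0=(0,\theta_1']$, $\varTheta_{m-1}=[\theta_{m-1}'',\infty)$, $\varTheta_i=[\theta_i'',\theta_{i+1}']$ for $1\le i\le m-2$, where $0<\theta_i'<\theta_i<\theta_i''$ for $1\le i\le m-1$ and $\theta_i''\le\theta_{i+1}'$ for $1\le i\le m-2$. $\Upsilon(d_1,d_2,\alpha)$ denotes the $100\alpha\%$ quantile of the $F$-distribution with $d_1$ and $d_2$ degrees of freedom: $\Pr\{(U/d_1)/(V/d_2)\le\Upsilon(d_1,d_2,\alpha)\}=\alpha$ for independent chi-square variables $U,V$ of $d_1$ and $d_2$ degrees of freedom. Multistage plan: sampling continues until the first stage $\ell$ with $D_\ell\ne0$; $H_j$ is accepted if then $D_\ell=j+1$; ''Reject $H_i$'' means that some $H_j$ with $j\ne i$ is accepted. $\zeta>0$ is a tuning parameter; $\alpha_i,\beta_i$ are functions of $\zeta$, and $s$ and the sample sizes may depend on $\zeta$. $\delta=O(\zeta)$ means: $\delta$ is a function of $\zeta>0$ for which there are positive constants $A,B$ with $A<\delta/\zeta<B$ for all sufficiently small $\zeta>0$. *)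

(* Defs.v *)
From HB Require Import structures.
From mathcomp Require Import all_boot all_order all_algebra.
From mathcomp Require Import all_classical all_reals all_analysis.
From mathcomp Require Import measurable_realfun.
Set Implicit Arguments.
Unset Strict Implicit.
Unset Printing Implicit Defensive.
Import Order.TTheory GRing.Theory Num.Theory.
Import numFieldNormedType.Exports.
Local Open Scope classical_set_scope.
Local Open Scope ring_scope.

Section FDistribution.
Context {R : realType}.

Local Notation RR := (measurableTypeR R * measurableTypeR R)%type.

Definition sqr_add (p : RR) : measurableTypeR R := p.1 ^+ 2 + p.2.

Lemma measurable_sqr_add : measurable_fun [set: RR] sqr_add.
Proof.
apply: (@measurable_funD).
  by apply: measurable_funX; exact: measurable_fst.
exact: measurable_snd.
Qed.

HB.instance Definition _ :=
  isMeasurableFun.Build _ _ _ _ sqr_add measurable_sqr_add.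

(* Law of Z_1^2 + ... + Z_k^2 for independent standard normal Z_1, ..., Z_k. *)
Fixpoint chisq_prob (k : nat) : probability (measurableTypeR R) R :=
  if k is k'.+1 then distribution (normal_prob 0 1 \x chisq_prob k')%E sqr_add
  else @dirac _ (measurableTypeR R) 0 R.

Definition F_ratio (d1 d2 : nat) (p : RR) : R :=
  (p.1 / d1%:R) / (p.2 / d2%:R).

Definition F_cdf (d1 d2 : nat) (q : R) : \bar R :=
  (chisq_prob d1 \x chisq_prob d2)%E [set p | F_ratio d1 d2 p <= q].

(* The q with F_cdf d1 d2 q = a; it exists and is unique for 0 < d1, 0 < d2
   and 0 < a < 1, and the default 0 is irrelevant in that range. *)
Definition F_quantile (d1 d2 : nat) (a : R) : R :=
  xget 0 [set q | F_cdf d1 d2 q = a%:E].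

End FDistribution.

Section Sampling.
Context {R : realType} {d : measure_display} {T : measurableType d}
  (P : probability T R).

Definition normally_distributed (mu sigma : R) (X : {RV P >-> R}) : Prop :=
  forall A : set R, measurable A -> distribution P X A = normal_prob mu sigma A.

Definition mutually_independent (I : choiceType) (Z : I -> {RV P >-> R}) : Prop :=
  forall (J : seq I) (A : I -> set R), uniq J -> (forall i, measurable (A i)) ->
    P (\bigcap_(i in [set` J]) (Z i @^-1` A i)) =
    (\prod_(i <- J) P (Z i @^-1` A i))%E.

Definition pooled (X Y : nat -> {RV P >-> R}) (i : nat + nat) : {RV P >-> R} :=
  match i with inl k => X k | inr k => Y k end.

Definition normal_samples (muX sigmaX muY sigmaY : R)
    (X Y : nat -> {RV P >-> R}) : Prop :=
  [/\ forall k, normally_distributed muX sigmaX (X k),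
      forall k, normally_distributed muY sigmaY (Y k) &
      mutually_independent (pooled X Y)].

End Sampling.

Section Plan.
Context {R : realType}.
Implicit Types (theta alpha beta f g : nat -> R) (i j l m : nat).

(* delta z = O(z) in the two-sided sense, as z decreases to 0. *)
Definition order_zeta (delta : R -> R) : Prop :=
  exists A B : R, [/\ 0 < A, 0 < B &
    \forall z \near 0^'+, A < delta z / z < B].

Definition zone theta' theta'' m i : set R :=
  if i == 0%N then `]0, theta' 1%N]%classic
  else if i == m.-1 then `[theta'' i, +oo[%classic
  else `[theta'' i, theta' i.+1]%classic.

(* nx and ny are the sample sizes at the stage under consideration. *)
Definition u_bound (nx ny : nat) (a : R) : R :=
  Num.max 1 (F_quantile nx.-1 ny.-1 (1 - a)).

Definition v_bound (nx ny : nat) (b : R) : R :=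
  Num.min 1 (F_quantile nx.-1 ny.-1 b).

Definition f_bound theta' theta'' alpha beta (nx ny i : nat) : R :=
  let tu := theta' i * u_bound nx ny (alpha i) in
  let tv := theta'' i * v_bound nx ny (beta i) in
  Num.min tv ((tu + tv) / 2).

Definition g_bound theta' theta'' alpha beta (nx ny i : nat) : R :=
  let tu := theta' i * u_bound nx ny (alpha i) in
  let tv := theta'' i * v_bound nx ny (beta i) in
  Num.max tu ((tu + tv) / 2).

(* The n first observations are x 0, ..., x n.-1. *)
Definition sample_mean (x : nat -> R) (n : nat) : R := (\sum_(k < n) x k) / n%:R.

Definition sum_sq_dev (x : nat -> R) (n : nat) : R :=
  \sum_(k < n) (x k - sample_mean x n) ^+ 2.

Definition theta_hat (x y : nat -> R) (nx ny : nat) : R :=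
  (ny.-1%:R * sum_sq_dev x nx) / (nx.-1%:R * sum_sq_dev y ny).

(* The three cases exclude one another and at most one i satisfies the middle
   one, because theta'' i <= theta' i.+1, v_bound <= 1 <= u_bound and
   f i <= g i; so taking the head of the list loses nothing. *)
Definition decision m f g (t : R) : nat :=
  if t <= f 1%N then 1%N
  else if g m.-1 < t then m
  else head 0%N [seq i <- index_iota 2 m | (g i.-1 < t) && (t <= f i)].

Definition D theta' theta'' alpha beta m (nX nY : nat -> nat)
    (x y : nat -> R) l : nat :=
  decision m (f_bound theta' theta'' alpha beta (nX l) (nY l))
             (g_bound theta' theta'' alpha beta (nX l) (nY l))
             (theta_hat x y (nX l) (nY l)).

End Plan.

Definition accepted (s : nat) (D : nat -> nat) (j : nat) : Prop :=
  exists l : nat, [/\ (1 <= l <= s)%N,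
    forall k, (1 <= k < l)%N -> D k = 0%N & D l = j.+1].

Definition rejected (m s : nat) (D : nat -> nat) (i : nat) : Prop :=
  exists j : nat, [/\ (j < m)%N, j <> i & accepted s D j].

(* Main.v *)
(* The statistic theta_hat / theta has the F-distribution with (n^X - 1, n^Y - 1) degrees of
   freedom, so at every stage each way of rejecting H_i has probability at most some alpha_k or
   beta_k, hence O(zeta).  By Chernoff bounds for the chi-square law, the F-distribution puts mass
   at most 4 rho^l outside a fixed neighbourhood of 1 at stage l, with rho < 1.  As soon as this is
   below every alpha_k and beta_k, the quantiles u and v lie in that neighbourhood, so f and g stay
   away from theta and the rejection probability is itself at most 4 rho^l.  Interpolating
   geometrically, it is at most C sqrt(zeta) rho^(l/2) at every stage, and summing over the stages
   leaves O(sqrt(zeta)), however many stages there are.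

   The law of the sample variance comes from a recursion on the sample size: adding one observation
   rotates the pair (normalized sum, new observation) in the plane, and the squared second coordinate
   of the rotated pair is the increment of the sum of squared deviations. *)

From HB Require Import structures.
Require Import Defs.
From mathcomp Require Import all_boot all_order all_algebra.
From mathcomp Require Import ring lra zify.
From mathcomp Require Import all_classical all_reals all_analysis.
From mathcomp Require Import measurable_realfun.
Import Order.TTheory GRing.Theory Num.Theory.
Import numFieldNormedType.Exports.
Set Implicit Arguments.
Unset Strict Implicit.
Unset Printing Implicit Defensive.
Local Open Scope classical_set_scope.
Local Open Scope ring_scope.

(** * The standard normal law *)

Section NormalLaw.
Context {R : realType}.
Local Notation leb := (@lebesgue_measure R).
Local Notation MR := (measurableTypeR R).

(** Lebesgue measure is [a] times its own image under [x |-> a * x + b], because the two agree on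
    half-open intervals. Integrating against the image gives the substitution rule. *)
Lemma ge0_integral_affine (a b : R) (f : MR -> \bar R) : 0 < a ->
  measurable_fun setT f -> (forall x, 0 <= f x)%E ->
  (\int[leb]_x f x = a%:E * \int[leb]_x f (a * x + b)%R)%E.
Proof.
move=> a0 mf f0.
pose phi : MR -> MR := fun x => a * x + b.
have mphi : measurable_fun setT phi.
  by apply: measurable_funD => //; apply: measurable_funM.
pose k : {nonneg R} := NngNum (ltW a0).
pose m : {measure set MR -> \bar R} := mscale k (pushforward leb phi).
have E A : measurable A -> leb A = m mphi A.
  apply: lebesgue_measure_unique => X /ocitvP[->|[[x y] /= xy ->]].
    by rewrite !measure0.
  rewrite /m /mscale /= /pushforward.
  have -> : phi @^-1` `]x, y]%classic = `](x - b) / a, (y - b) / a]%classic.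
    apply/seteqP; split => t /=; rewrite !in_itv/= /phi ltr_pdivrMr// ler_pdivlMr//
      ltrBlDr lerBrDr mulrC //.
  rewrite !lebesgue_measure_itv /= !lte_fin ltr_pM2r ?invr_gt0// ltrD2r xy.
  rewrite -!EFinB -EFinM; congr EFin; field; lra.
rewrite (eq_measure_integral (m mphi)) /=; last by move=> A mA _; exact: E.
rewrite ge0_integral_mscale//= ge0_integral_pushforward//=.
Qed.

(** The Radon-Nikodym derivative of the law and [normal_pdf] have the same integral over every
    measurable set, hence agree almost everywhere. *)
Lemma ge0_integral_normal_prob (m s : R) (f : MR -> \bar R) :
  measurable_fun setT f -> (forall x, 0 <= f x)%E ->
  (\int[normal_prob m s]_x f x = \int[leb]_x (f x * (normal_pdf m s x)%:E))%E.
Proof.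
move=> mf f0.
have dom := @normal_prob_dominates R m s.
rewrite -(Radon_Nikodym_SigmaFinite.change_of_variables dom)//=.
apply: ae_eq_integral => //.
- apply: emeasurable_funM => //; apply: (measurable_int leb).
  exact: Radon_Nikodym_SigmaFinite.f_integrable.
- apply: emeasurable_funM => //; apply/measurable_EFinP.
  exact: measurable_normal_pdf.
- apply: ae_eqe_mul2l => /=; apply: integral_ae_eq => //=.
  + exact: Radon_Nikodym_SigmaFinite.f_integrable.
  + by apply/measurable_EFinP; exact: measurable_normal_pdf.
  + move=> E _ mE; rewrite -(Radon_Nikodym_SigmaFinite.f_integral dom)//.
Qed.

(** After substituting [s * x + mu] for [x], the Jacobian [s] cancels the factor [s] in the peak of
    the density. *)
Lemma normal_prob_standardize (mu s : R) (A : set MR) : 0 < s -> measurable A ->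
  normal_prob mu s [set x | A ((x - mu) / s)] = normal_prob 0 1 A.
Proof.
move=> s0 mA.
have mphi : measurable_fun setT (fun x : MR => (x - mu) / s : MR).
  by apply: measurable_funM => //; apply: measurable_funB.
have mB : measurable [set x | A ((x - mu) / s)].
  by rewrite -[X in measurable X]setTI; exact: mphi.
rewrite /normal_prob integral_mkcond [RHS]integral_mkcond.
set B := [set x | _] in mB *.
have mpdf (C : set MR) m t : measurable C ->
    measurable_fun setT ((fun x => (normal_pdf m t x)%:E) \_ C).
  move=> mC; apply/(measurable_restrictT _ _).1 => //.
  by apply/measurable_EFinP/measurable_funTS; exact: measurable_normal_pdf.
rewrite (@ge0_integral_affine s mu)//; last 2 first.
- exact: mpdf.
- by move=> x; rewrite patchE; case: ifP => // _; rewrite lee_fin normal_pdf_ge0.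
rewrite -ge0_integralZl//; last 3 first.
- have mh : measurable_fun setT (fun x : MR => s * x + mu : MR).
    by apply: measurable_funD => //; apply: measurable_funM.
  exact: (measurableT_comp (mpdf _ _ _ mB) mh).
- by move=> x _; rewrite patchE; case: ifP => // _; rewrite lee_fin normal_pdf_ge0.
- by rewrite lee_fin ltW.
apply: eq_integral => x _; rewrite !patchE.
have -> : (s * x + mu \in B) = (x \in A).
  by apply/idP/idP; rewrite !inE /B /= addrK mulrAC divff ?gt_eqF// mul1r.
case: ifP => _; last by rewrite mule0.
rewrite -EFinM; congr EFin.
rewrite !normal_pdfE ?oner_eq0 ?gt_eqF//  /normal_fun /normal_peak.
have -> : Num.sqrt (s ^+ 2 * pi *+ 2) = s * Num.sqrt (1 ^+ 2 * pi *+ 2).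
  rewrite expr1n mul1r -mulrnAr sqrtrM ?sqr_ge0// sqrtr_sqr gtr0_norm//.
rewrite mulrA invfM mulrA divff ?gt_eqF// mul1r; congr (_ * expR _).
by field; rewrite gt_eqF.
Qed.

Lemma normal_pdf01 (x : R) :
  normal_pdf 0 1 x = (Num.sqrt (pi *+ 2))^-1 * expR (- (x ^+ 2) / 2).
Proof.
by rewrite normal_pdfE ?oner_eq0//  /normal_fun /normal_peak subr0
  expr1n mul1r.
Qed.

(** The product density depends only on [x ^+ 2 + y ^+ 2], which a rotation preserves. *)
Lemma normal_pdf01_rotation (c s x y : R) : c ^+ 2 + s ^+ 2 = 1 ->
  normal_pdf 0 1 (c * x - s * y) * normal_pdf 0 1 (c * y + s * x) =
  normal_pdf 0 1 x * normal_pdf 0 1 y.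
Proof.
move=> cs; rewrite !normal_pdf01 mulrACA -expRD [RHS]mulrACA -expRD.
congr (_ * expR _).
have -> : - x ^+ 2 / 2 + - y ^+ 2 / 2 = (c ^+ 2 + s ^+ 2) * (- (x ^+ 2 + y ^+ 2) / 2).
  by rewrite cs; field.
by field.
Qed.

Local Notation N01 := (normal_prob (0 : R) 1).
(** The rotation is factored into two changes of a single coordinate, so that one-dimensional affine
    substitution and Fubini-Tonelli suffice. The factorization divides by [c]. *)
Lemma ge0_integral_normal_rotation (c s : R) (f : MR * MR -> \bar R) : 0 < c ->
  c ^+ 2 + s ^+ 2 = 1 -> measurable_fun setT f -> (forall x, 0 <= f x)%E ->
  (\int[N01 \x N01]_p f ((c * p.1 + s * p.2)%R, (c * p.2 - s * p.1)%R) =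
   \int[N01 \x N01]_p f p)%E.
Proof.
move=> c0 cs mf f0.
have c_ne0 : c != 0 by rewrite gt_eqF.
pose phi := normal_pdf (0 : R) 1.
have mphi : measurable_fun setT phi by exact: measurable_normal_pdf.
have phi0 x : (0 <= (phi x)%:E)%E by rewrite lee_fin normal_pdf_ge0.
pose g (p : MR * MR) := f ((c * p.1 + s * p.2)%R, (c * p.2 - s * p.1)%R).
have mlin (a b : R) : measurable_fun setT (fun p : MR * MR => a * p.1 + b * p.2 : MR).
  by apply: measurable_funD; apply: measurable_funM.
have mg : measurable_fun setT g.
  apply: (measurableT_comp mf); apply/measurable_fun_pairP; split => /=.
    exact: mlin.
  by refine (@eq_measurable_fun _ _ _ _ _ _ _ _ (mlin (- s) c)) => p _ /=; rewrite mulNr addrC.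
have NE (h : MR -> \bar R) : measurable_fun setT h -> (forall x, 0 <= h x)%E ->
    (\int[N01]_x h x = \int[leb]_x (h x * (phi x)%:E))%E.
  exact: ge0_integral_normal_prob.
rewrite -[LHS]/(\int[N01 \x N01]_p g p)%E.
have g0 p : (0 <= g p)%E by exact: f0.
apply: (eq_trans (fubini_tonelli2 (m1 := N01) (m2 := N01) g mg g0)).
apply: (eq_trans _ (esym (fubini_tonelli1 (m1 := N01) (m2 := N01) f mf f0))).
rewrite /fubini_F /fubini_G.
have mG : measurable_fun setT (fun y => \int[N01]_x g (x, y))%E.
  exact: measurable_fun_fubini_tonelli_G.
have mF : measurable_fun setT (fun x => \int[N01]_y f (x, y))%E.
  exact: measurable_fun_fubini_tonelli_F.
rewrite NE//; last by move=> y; apply: integral_ge0.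
rewrite [RHS]NE//; last by move=> y; apply: integral_ge0.
(* Mixed coordinates: the first argument of [h] is the rotated [u = c x + s y], the second is still
   [y]. Then [x = (u - s y) / c], the other rotated coordinate is [(y - s u) / c], and [1 / c] is
   the Jacobian. *)
pose h (p : MR * MR) := (f (p.1, (p.2 - s * p.1) / c)%R *
   (phi ((p.1 - s * p.2) / c) * phi p.2 / c)%R%:E)%E.
have maff (a b : R) : measurable_fun setT (fun p : MR * MR => (a * p.1 + b * p.2) / c : MR).
  by apply: measurable_funM => //; exact: mlin.
have mh : measurable_fun setT h.
  apply: emeasurable_funM.
    apply: (measurableT_comp mf); apply/measurable_fun_pairP; split.
      exact: measurable_fst.
    by refine (@eq_measurable_fun _ _ _ _ _ _ _ _ (maff (- s) 1)) => p _ /=; rewrite mul1r mulNr addrC.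
  apply/measurable_EFinP; apply: measurable_funM => //.
  apply: measurable_funM; last by apply: measurableT_comp.
  apply: (measurableT_comp mphi).
  by refine (@eq_measurable_fun _ _ _ _ _ _ _ _ (maff 1 (- s))) => p _ /=; rewrite mul1r mulNr.
have h0 p : (0 <= h p)%E.
  by rewrite mule_ge0// lee_fin mulr_ge0 ?invr_ge0 ?(ltW c0)// mulr_ge0// normal_pdf_ge0.
transitivity (\int[leb]_y \int[leb]_x h (x, y))%E.
  apply: eq_integral => y _.
  rewrite NE//; last exact: measurable_fun_pair1.
  rewrite -ge0_integralZr//; last 2 first.
  - apply: emeasurable_funM; first exact: measurable_fun_pair1.
    exact/measurable_EFinP.
  - by move=> x _; rewrite mule_ge0.
  rewrite [RHS](@ge0_integral_affine c (s * y))//; last exact: measurable_fun_pair1.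
  rewrite -ge0_integralZl//; last 2 first.
  - have ma : measurable_fun setT (fun x : MR => c * x + s * y : MR).
      by apply: measurable_funD => //; apply: measurable_funM.
    exact: (measurableT_comp (measurable_fun_pair1 y mh) ma).
  - by rewrite lee_fin ltW.
  apply: eq_integral => x _; rewrite /g /h /=.
  rewrite muleCA -!muleA; congr (f (_, _) * _)%E.
    apply: (mulfI c_ne0); rewrite mulrCA divff// mulr1.
    have -> : y - s * (c * x + s * y) = (c ^+ 2 + s ^+ 2) * y - s * (c * x + s * y).
      by rewrite cs mul1r.
    by ring.
  rewrite -!EFinM; congr EFin; rewrite addrK.
  by rewrite [c * x / c]mulrAC divff// mul1r; field.
(* With the integrals exchanged, [u] is fixed and [y = c v + s u] introduces the second rotated
   coordinate [v]. *)
rewrite -fubini_tonelli//.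
apply: eq_integral => x _.
rewrite NE//; last exact: measurable_fun_pair2.
rewrite -ge0_integralZr//; last 2 first.
- apply: emeasurable_funM; first exact: measurable_fun_pair2.
  exact/measurable_EFinP.
- by move=> y _; rewrite mule_ge0.
rewrite [LHS](@ge0_integral_affine c (s * x))//; last exact: measurable_fun_pair2.
rewrite -ge0_integralZl//; last 2 first.
- have ma : measurable_fun setT (fun y : MR => c * y + s * x : MR).
    by apply: measurable_funD => //; apply: measurable_funM.
  exact: (measurableT_comp (measurable_fun_pair2 x mh) ma).
- by rewrite lee_fin ltW.
apply: eq_integral => y _; rewrite /h /=.
rewrite muleCA -!muleA addrK [c * y / c]mulrAC divff// mul1r.
congr (_ * _)%E; rewrite -!EFinM; congr EFin.
have -> : (x - s * (c * y + s * x)) / c = c * x - s * y.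
  apply: (mulfI c_ne0); rewrite mulrCA divff// mulr1.
  have -> : x - s * (c * y + s * x) = (c ^+ 2 + s ^+ 2) * x - s * (c * y + s * x).
    by rewrite cs mul1r.
  by ring.
rewrite normal_pdf01_rotation// mulrC mulrVK ?unitfE// mulrC //.
Qed.
End NormalLaw.

(** * The chi-square law *)

Section ChiSquare.
Context {R : realType}.
Local Notation MR := (measurableTypeR R).
Local Notation N01 := (normal_prob (0 : R) 1).

Lemma ge0_integral_chisqS k (f : MR -> \bar R) : measurable_fun setT f ->
  (forall x, 0 <= f x)%E ->
  (\int[chisq_prob k.+1]_q f q =
   \int[N01]_z \int[chisq_prob k]_q f (z ^+ 2 + q)%R)%E.
Proof.
move=> mf f0.
rewrite [LHS]ge0_integral_distribution//.
apply: (@fubini_tonelli1 _ _ _ _ _ N01 (chisq_prob k) (f \o sqr_add)) => //.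
  by apply: measurableT_comp => //; exact: measurable_sqr_add.
by move=> p; exact: f0.
Qed.

(** The moment generating function of [z ^+ 2] at [t] is [(1 - 2 t)^(-1/2)]. Taking this value [s]
    as the parameter turns the integrand into [s] times the centred normal density of standard
    deviation [s]. *)
Lemma normal_mgf_sqr (s : R) : 0 < s ->
  (\int[N01]_z (expR ((1 - s ^- 2) / 2 * z ^+ 2))%:E = s%:E)%E.
Proof.
move=> s0.
rewrite ge0_integral_normal_prob//; last first.
  apply/measurable_EFinP; apply: measurableT_comp => //.
  by apply: measurable_funM => //; apply: measurable_funX.
transitivity (\int[lebesgue_measure]_x (s%:E * (normal_pdf 0 s x)%:E))%E.
  apply: eq_integral => x _; rewrite -!EFinM; congr EFin.
  rewrite normal_pdf01 mulrCA -expRD.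
  rewrite normal_pdfE ?gt_eqF// /normal_fun /normal_peak.
  have -> : Num.sqrt (s ^+ 2 * pi *+ 2) = s * Num.sqrt (pi *+ 2).
    by rewrite -mulrnAr sqrtrM ?sqr_ge0// sqrtr_sqr gtr0_norm.
  have w0 : Num.sqrt (pi *+ 2) != 0 :> R by rewrite gt_eqF// sqrtr_gt0 mulrn_wgt0// pi_gt0.
  rewrite [RHS]mulrA; congr (_ * expR _); first by field; rewrite w0 gt_eqF.
  by field; rewrite gt_eqF.
rewrite ge0_integralZl//; last 3 first.
- by apply/measurable_EFinP; exact: measurable_normal_pdf.
- by move=> x _; rewrite lee_fin normal_pdf_ge0.
- by rewrite lee_fin ltW.
by rewrite integral_normal_pdf mule1.
Qed.

Lemma chisq_mgf (s : R) k : 0 < s ->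
  (\int[chisq_prob k]_q (expR ((1 - s ^- 2) / 2 * q))%:E = (s ^+ k)%:E)%E.
Proof.
move=> s0; set t := (1 - s ^- 2) / 2.
have me : measurable_fun setT (fun q : MR => (expR (t * q))%:E).
  by apply/measurable_EFinP; apply: measurableT_comp.
have mz : measurable_fun setT (fun z : MR => (expR (t * z ^+ 2))%:E).
  apply/measurable_EFinP; apply: measurableT_comp => //.
  by apply: measurable_funM => //; apply: measurable_funX.
elim: k => [|k IH].
  by rewrite /= integral_dirac//= diracT mul1e mulr0 expR0.
rewrite ge0_integral_chisqS//.
transitivity (\int[N01]_z ((s ^+ k)%:E * (expR (t * z ^+ 2))%:E))%E.
  apply: eq_integral => z _.
  rewrite -IH -ge0_integralZr//.
  by apply: eq_integral => q _; rewrite -EFinM mulrDr expRD mulrC.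
rewrite ge0_integralZl//; last by rewrite lee_fin exprn_ge0// ltW.
by rewrite normal_mgf_sqr// -EFinM exprSr.
Qed.

(** The minimum over [t < 1/2] of [exp (- t a) (1 - 2 t)^(-1/2)], attained at
    [t = (1 - a^-1) / 2]. *)
Definition chernoff_rate (a : R) : R := Num.sqrt a * expR (- (a - 1) / 2).

Lemma chernoff_rate_gt0 a : 0 < a -> 0 < chernoff_rate a.
Proof. by move=> a0; rewrite mulr_gt0 ?expR_gt0// sqrtr_gt0. Qed.

(** The square of the rate is [a / exp (a - 1)], and [1 + x < exp x] for [x != 0]. *)
Lemma chernoff_rate_lt1 a : 0 < a -> a != 1 -> chernoff_rate a < 1.
Proof.
move=> a0 a1; rewrite -(@ltr_pXn2r _ 2)// ?nnegrE ?ler01 ?ltW ?chernoff_rate_gt0//.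
rewrite expr1n exprMn sqr_sqrtr ?ltW// -expRM_natl.
have -> : 2%:R * (- (a - 1) / 2) = - (a - 1) by field.
rewrite expRN ltr_pdivrMr ?expR_gt0// mul1r.
have := @expR_gt1Dx _ (a - 1); rewrite subr_eq0 => /(_ a1).
by rewrite [1 + _]addrC subrK.
Qed.

(* The event is [a * k <= q] when [1 < a], and [q <= a * k] when [a < 1]. *)
Lemma chisq_chernoff (a : R) k : 0 < a ->
  (chisq_prob k [set q | (0 <= (1 - a^-1) * (q - a * k%:R))%R] <=
   (chernoff_rate a ^+ k)%:E)%E.
Proof.
move=> a0; set E := [set q | _].
have mE : measurable (E : set MR).
  rewrite -[X in measurable X]setTI.
  have : measurable_fun setT (fun q : MR => 0 <= (1 - a^-1) * (q - a * k%:R)).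
    apply: measurable_fun_ler => //; apply: measurable_funM => //.
    by apply: measurable_funB.
  by move=> /(_ measurableT [set true]); exact.
(* This exponent has the sign of [a - 1], so a single exponential Markov inequality covers both
   tails. *)
set t := (1 - a^-1) / 2.
have -> : (chernoff_rate a ^+ k)%:E =
    ((expR (- t * (a * k%:R)))%:E * \int[chisq_prob k]_q (expR (t * q))%:E)%E.
  have -> : t = (1 - Num.sqrt a ^- 2) / 2 by rewrite sqr_sqrtr// ltW.
  rewrite chisq_mgf ?sqrtr_gt0// -EFinM; congr EFin.
  rewrite mulrA expRM_natr -exprMn mulrC; congr ((_ * expR _) ^+ _).
  by rewrite sqr_sqrtr ?ltW//; field; rewrite gt_eqF.
have me : measurable_fun setT (fun q : MR => (expR (t * q))%:E).
  by apply/measurable_EFinP; apply: measurableT_comp.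
rewrite -ge0_integralZl//.
rewrite -[X in chisq_prob k X]setIT -integral_indic//.
apply: ge0_le_integral => //.
- exact/measurable_EFinP/measurable_indic.
- by apply: emeasurable_funM.
move=> q _; rewrite -EFinM lee_fin -expRD indicE.
have [/set_mem qE|_] := boolP (q \in E); last by rewrite expR_ge0.
rewrite -[leLHS]expR0 ler_expR.
have : 0 <= (1 - a^-1) * (q - a * k%:R) / 2 by rewrite divr_ge0.
by congr (0 <= _); rewrite /t; field; rewrite gt_eqF.
Qed.

(** With the other summands fixed at total [q], the equation [z ^+ 2 + q = x] has at most two
    solutions [z], a null set for the normal law. *)
Lemma chisq_prob_set1 k (x : R) : chisq_prob k.+1 [set x] = 0%E.
Proof.
rewrite -[X in chisq_prob _ X]setIT -integral_indic// ge0_integral_chisqS//; last first.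
  exact/measurable_EFinP/measurable_indic.
pose f (p : MR * MR) : \bar R := (\1_[set x] (sqr_add p))%:E.
have mf : measurable_fun setT f.
  by apply/measurable_EFinP; apply: measurableT_comp => //; exact: measurable_sqr_add.
transitivity (\int[chisq_prob k]_q \int[N01]_z f (z, q))%E.
  by apply: (@fubini_tonelli _ _ _ _ _ N01 (chisq_prob k) f mf) => p; rewrite lee_fin.
apply: integral0_eq => q _.
pose B : set MR := [set z | z ^+ 2 + q = x].
have mB : measurable B.
  have : measurable_fun setT (fun z : MR => z ^+ 2 + q : MR).
    by apply: measurable_funD => //; apply: measurable_funX.
  by move=> /(_ measurableT [set x]); rewrite setTI; exact.
transitivity (\int[N01]_z (\1_B z)%:E)%E.
  by apply: eq_integral => z _; rewrite /f !indicE /sqr_add /=;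
    congr ((_ : nat)%:R)%:E; apply/idP/idP; rewrite !inE.
rewrite integral_indic// setIT.
have /null_content_dominatesP := @normal_prob_dominates R 0 1.
apply => //; apply: countable_lebesgue_measure0.
apply: (@sub_countable _ _ _ [set Num.sqrt (x - q); - Num.sqrt (x - q)]).
  apply: subset_card_le => z /= <-; rewrite addrK sqrtr_sqr.
  by have [z0|z0] := ger0P z; [left|right; rewrite opprK].
exact: finite_set_countable.
Qed.
End ChiSquare.

(** * Existence of quantiles *)

Section Quantile.
Context {R : realType} {d : measure_display} {T : measurableType d}
  (P : probability T R).

Lemma measure_bigcup_le (F : (set T)^nat) (b : \bar R) :
  (forall n, measurable (F n)) -> nondecreasing_seq F ->
  (forall n, (P (F n) <= b)%E) -> (P (\bigcup_n F n) <= b)%E.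
Proof.
move=> mF ndF Fb.
have := @nondecreasing_cvg_mu _ _ _ P F mF (bigcupT_measurable _ mF) ndF.
by move=> /cvge_to_le; apply; apply: nearW => n; exact: Fb.
Qed.

(** At [q0], the supremum of the points where the distribution function is at most [a], continuity
    from below gives [P(X < q0) <= a] and [P(X > q0) <= 1 - a]. Since [q0] carries no mass, the
    value there is exactly [a]. *)
Lemma cdf_surjective (X : {RV P >-> R}) (a : R) :
  (forall q, P (X @^-1` [set q]) = 0%E) ->
  0 < a < 1 -> exists q, cdf X q = a%:E.
Proof.
move=> P0 /andP[a0 a1].
have mX (A : set R) : measurable A -> measurable (X @^-1` A).
  by move=> mA; exact: measurable_funPTI.
pose S := [set q | (cdf X q <= a%:E)%E].
have cdfE q : ((fine (cdf X q))%:E = cdf X q)%E by rewrite fineK// fin_num_measure.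
have S_ne : S !=set0.
  have [q qa] := filter_ex (cvgr_lt _ (fine_cvg (cvg_cdfNy0 X)) _ a0).
  by exists q; rewrite /S /= -cdfE lee_fin ltW.
have S_ub : has_ubound S.
  have [q qa] := filter_ex (cvgr_gt _ (fine_cvg (cvg_cdfy1 X)) _ a1).
  exists q => r; rewrite /S /= -cdfE lee_fin => ra; rewrite leNgt; apply/negP => qr.
  have := le_lt_trans ra qa; rewrite ltNge => /negP; apply.
  by rewrite -lee_fin !cdfE; apply: cdf_nondecreasing; exact: ltW.
pose q0 := sup S.
have hn n : 0 < (n.+1%:R : R)^-1 by rewrite invr_gt0.
have le_inv (n k : nat) : (n <= k)%N -> (k.+1%:R : R)^-1 <= n.+1%:R^-1.
  by move=> nk; rewrite lef_pV2 ?posrE// ler_nat ltnS.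
have lo : (P (X @^-1` `]-oo, q0[) <= a%:E)%E.
  have -> : X @^-1` `]-oo, q0[%classic =
      \bigcup_n X @^-1` `]-oo, q0 - n.+1%:R^-1]%classic.
    apply/seteqP; split => [w /=|w [n _] /=]; rewrite !in_itv/=.
      rewrite -subr_gt0 => /ltr_add_invr[n]; rewrite add0r => wn.
      by exists n => //=; rewrite in_itv /= lerBrDl -lerBrDr ltW.
    by move=> wn; apply: (le_lt_trans wn); rewrite gtrBl.
  apply: measure_bigcup_le => [n|n k nk|n].
  - exact: mX.
  - apply/subsetPset => w /=; rewrite !in_itv/= => /le_trans; apply.
    by rewrite lerD2l lerN2 le_inv.
  - have [q Sq qn] := sup_adherent (hn n) (conj S_ne S_ub).
    by apply: (le_trans _ Sq); apply: cdf_nondecreasing; exact: ltW.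
have hi : (P (X @^-1` `]q0, +oo[) <= (1 - a)%:E)%E.
  have -> : X @^-1` `]q0, +oo[%classic =
      \bigcup_n X @^-1` `]q0 + n.+1%:R^-1, +oo[%classic.
    apply/seteqP; split => [w /=|w [n _] /=]; rewrite !in_itv/= !andbT.
      move=> /ltr_add_invr[n wn].
      by exists n => //=; rewrite in_itv /= andbT.
    by apply: le_lt_trans; rewrite lerDl ltW.
  apply: measure_bigcup_le => [n|n k nk|n].
  - exact: mX.
  - apply/subsetPset => w /=; rewrite !in_itv/= !andbT; apply: le_lt_trans.
    by rewrite lerD2l le_inv.
  - have : (a%:E < cdf X (q0 + n.+1%:R^-1))%E.
      rewrite ltNge; apply/negP => /(ub_le_sup S_ub).
      by apply/negP; rewrite -ltNge ltrDl.
    have -> : X @^-1` `]q0 + n.+1%:R^-1, +oo[%classic =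
        ~` (X @^-1` `]-oo, q0 + n.+1%:R^-1]%classic).
      by rewrite preimage_setC setCitvl.
    rewrite probability_setC; last exact: mX.
    rewrite -[P _]/(cdf X (q0 + n.+1%:R^-1)) -cdfE -EFinB lte_fin lee_fin; lra.
exists q0; apply/eqP; rewrite eq_le; apply/andP; split.
  have -> : cdf X q0 = (P (X @^-1` `]-oo, q0[) + P (X @^-1` [set q0]))%E.
    rewrite -measureU; [|exact: mX|exact: mX|].
      by rewrite -preimage_setU setUitv1.
    by rewrite -preimage_setI; apply/seteqP; split => w //= [] /[swap] ->; rewrite in_itv /= ltxx.
  by rewrite P0 adde0.
move: hi; have -> : X @^-1` `]q0, +oo[%classic = ~` (X @^-1` `]-oo, q0]%classic).
  by rewrite preimage_setC setCitvl.
rewrite probability_setC; last exact: mX.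
rewrite -[P _]/(cdf X q0) -cdfE -EFinB !lee_fin; lra.
Qed.
End Quantile.

(** * The F-distribution *)

Section FDistributionTheory.
Context {R : realType}.
Local Notation MR := (measurableTypeR R).
Local Notation chi2 d1 d2 := (chisq_prob d1 \x chisq_prob d2)%E.

Lemma measurable_invr : measurable_fun setT (fun x : MR => x^-1 : MR).
Proof.
have -> : [set: MR] = [set~ 0] `|` [set 0] by rewrite setvU.
have o0 : open [set~ (0 : R)] by apply: closed_openC; apply: accessible_closed_set1; apply: hausdorff_accessible; exact: norm_hausdorff.
apply/measurable_funU => //; first exact: open_measurable.
split.
  by apply: open_continuous_measurable_fun => // x /set_mem /= /eqP x0; exact: inv_continuous.
exact: measurable_fun_set1.
Qed.

Lemma measurable_F_ratio d1 d2 :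
  measurable_fun setT (F_ratio d1 d2 : MR * MR -> MR).
Proof.
apply: measurable_funM.
  by apply: measurable_funM => //; exact: measurable_fst.
apply: (measurableT_comp measurable_invr).
by apply: measurable_funM => //; exact: measurable_snd.
Qed.

Definition F_le (d1 d2 : nat) (x : R) : set (MR * MR) := [set p | F_ratio d1 d2 p <= x].
Definition F_gt (d1 d2 : nat) (x : R) : set (MR * MR) := [set p | x < F_ratio d1 d2 p].

Lemma measurable_F_le d1 d2 x : measurable (F_le d1 d2 x).
Proof.
rewrite -[X in measurable X]setTI.
have := measurable_fun_ler (@measurable_F_ratio d1 d2) (measurable_cst x).
by move=> /(_ measurableT [set true]); exact.
Qed.

Lemma F_gtE d1 d2 x : F_gt d1 d2 x = ~` F_le d1 d2 x.
Proof.
by apply/seteqP; split => p; rewrite /F_gt /F_le /= ltNge => /negP.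
Qed.

Lemma measurable_F_gt d1 d2 x : measurable (F_gt d1 d2 x).
Proof. by rewrite F_gtE; apply: measurableC; exact: measurable_F_le. Qed.

(** The set [Z] of zero denominators, where division returns the default 0, is null and is split off
    first. Elsewhere each denominator leaves one numerator, which has chi-square mass 0. *)
Lemma F_ratio_atomless d1 d2 (x : R) : (0 < d1)%N -> (0 < d2)%N ->
  chi2 d1 d2 (F_ratio d1 d2 @^-1` [set x]) = 0%E.
Proof.
move=> d1_gt0 d2_gt0; set B := _ @^-1` _.
have mB : measurable (B : set (MR * MR)).
  by have := @measurable_F_ratio d1 d2 measurableT [set x]; rewrite setTI; exact.
have d1n0 : d1%:R != 0 :> R by rewrite pnatr_eq0 -lt0n.
have d2n0 : d2%:R != 0 :> R by rewrite pnatr_eq0 -lt0n.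
have chi0 d (y : R) : (0 < d)%N -> chisq_prob d [set y] = 0%E.
  by case: d => // d _; exact: chisq_prob_set1.
pose Z : set (MR * MR) := setT `*` [set 0].
have sub : B `<=` Z `|` (B `\` Z).
  by move=> p Bp; have [p0|p0] := pselect (Z p); [left|right].
have mZ : measurable Z by exact: measurableX.
have mD : measurable (B `\` Z) by exact: measurableD.
apply/eqP; rewrite -measure_le0.
apply: (@le_trans _ _ (chi2 d1 d2 Z +
    chi2 d1 d2 (B `\` Z))%E).
  apply: (le_trans (le_measure _ _ _ sub)); rewrite ?inE//.
    exact: measurableU.
  exact: measureU2.
rewrite {1}/Z product_measure1E// [X in (_ * X)%E]chi0// mule0 add0e.
rewrite -[X in chi2 _ _ X]setIT -integral_indic//.
have mI : measurable_fun setT (fun p : MR * MR => (\1_(B `\` Z) p)%:E : \bar R).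
  exact/measurable_EFinP/measurable_indic.
rewrite (@fubini_tonelli2 _ _ _ _ _ (chisq_prob d1) (chisq_prob d2) _ mI); last first.
  by move=> p; rewrite lee_fin.
rewrite /fubini_G integral0_eq// => y _.
have [->|y0] := eqVneq y 0.
  by apply: integral0_eq => z _; rewrite indicE memNset//= => -[_]; apply.
transitivity (\int[chisq_prob d1]_z (\1_[set (x * (y / d2%:R) * d1%:R)] z)%:E)%E.
  apply: eq_integral => z _; rewrite !indicE; congr ((nat_of_bool _)%:R)%:E.
  apply/idP/idP; rewrite !inE /= /F_ratio /=.
    by move=> [<- _]; rewrite /F_ratio /=; field; rewrite d1n0 d2n0 y0.
  move=> ->; split; last by case=> _ /eqP; rewrite (negbTE y0).
  by rewrite /B /F_ratio /=; field; rewrite d1n0 d2n0 y0.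
by rewrite integral_indic// setIT; exact: chi0.
Qed.

(** The ratio, as a random variable on the product space, has no atoms, so a solution exists and
    [xget] does not fall back on its default. *)
Lemma F_quantileE d1 d2 (a : R) : (0 < d1)%N -> (0 < d2)%N -> 0 < a < 1 ->
  F_cdf d1 d2 (F_quantile d1 d2 a) = a%:E.
Proof.
move=> d1_gt0 d2_gt0 a01.
have mF : measurable_fun setT (F_ratio d1 d2 : MR * MR -> R).
  exact: measurable_F_ratio.
pose fm : isMeasurableFun _ _ (MR * MR)%type R (F_ratio d1 d2) :=
  isMeasurableFun.Build _ _ _ _ _ mF.
pose X : {RV (chi2 d1 d2) >-> R} := (HB.pack (F_ratio d1 d2) fm : {mfun (MR * MR)%type >-> R}).
have [q qa] := @cdf_surjective R _ _ (chi2 d1 d2) X a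
  (fun q => F_ratio_atomless q d1_gt0 d2_gt0) a01.
have /(xgetPex 0) : exists q, [set q | F_cdf d1 d2 q = a%:E] q.
  exists q; rewrite /= -qa /F_cdf /cdf /distribution /pushforward.
  by congr (chi2 _ _ _); apply/seteqP; split => p /=; rewrite in_itv.
by [].
Qed.

Lemma F_gt_quantile d1 d2 (a : R) : (0 < d1)%N -> (0 < d2)%N -> 0 < a < 1 ->
  chi2 d1 d2 (F_gt d1 d2 (F_quantile d1 d2 (1 - a))) = a%:E.
Proof.
move=> d1_gt0 d2_gt0 a01.
rewrite F_gtE [LHS]probability_setC; last exact: measurable_F_le.
rewrite [X in (_ - X)%E](_ : _ = (1 - a)%:E).
  by rewrite -EFinB; congr EFin; lra.
by apply: F_quantileE => //; lra.
Qed.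

Definition F_tails (d1 d2 : nat) (c : R) : set (MR * MR) :=
  [set p | F_ratio d1 d2 p <= c^-1 \/ c <= F_ratio d1 d2 p].

Lemma measurable_F_tails d1 d2 (c : R) : measurable (F_tails d1 d2 c).
Proof.
have -> : F_tails d1 d2 c = F_le d1 d2 c^-1 `|` [set p | c <= F_ratio d1 d2 p] by [].
apply: measurableU; first exact: measurable_F_le.
rewrite -[X in measurable X]setTI.
have := measurable_fun_ler (measurable_cst c) (@measurable_F_ratio d1 d2).
by move=> /(_ measurableT [set true]); exact.
Qed.

(** With [a = sqrt c], if both chi-square variables divided by their degrees of freedom lie strictly
    between [a^-1] and [a], their ratio lies strictly between [c^-1] and [c]. The complement is
    covered by four Chernoff events, whence the factor 4; since the rates are below 1, [l] degrees
    of freedom are the worst case. *)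
Lemma F_tails_bound (c : R) : 1 < c -> exists rho : R, 0 < rho < 1 /\
  forall l d1 d2, (0 < l)%N -> (l <= d1)%N -> (l <= d2)%N ->
    (chi2 d1 d2 (F_tails d1 d2 c) <= (4 * rho ^+ l)%:E)%E.
Proof.
move=> c1.
have c0 : 0 < c by apply: lt_trans c1.
pose a := Num.sqrt c.
have a0 : 0 < a by rewrite sqrtr_gt0.
have aa : a * a = c by rewrite -expr2 sqr_sqrtr// ltW.
have a1 : 1 < a by rewrite -(@ltr_pXn2r _ 2)// ?nnegrE ?ltW// expr1n expr2 aa.
have b0 : 0 < a^-1 by rewrite invr_gt0.
have b1 : a^-1 < 1 by rewrite invf_lt1.
exists (Num.max (chernoff_rate a) (chernoff_rate a^-1)); split.
  by rewrite lt_max chernoff_rate_gt0//= gt_max !chernoff_rate_lt1// neq_lt ?a1 ?b1 ?orbT.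
set rho := Num.max _ _.
move=> l d1 d2 l0 ld1 ld2.
(* The upper tail [t * d <= q] for [t = a], the lower tail [q <= t * d] for [t = a^-1]. *)
pose E t d := [set q : MR | 0 <= (1 - t^-1) * (q - t * d%:R)].
have mE t d : measurable (E t d).
  rewrite -[X in measurable X]setTI.
  have : measurable_fun setT (fun q : MR => 0 <= (1 - t^-1) * (q - t * d%:R)).
    apply: measurable_fun_ler => //; apply: measurable_funM => //.
    by apply: measurable_funB.
  by move=> /(_ measurableT [set true]); exact.
have bd t d : (t == a) || (t == a^-1) -> (l <= d)%N ->
    (chisq_prob d (E t d) <= (rho ^+ l)%:E)%E.
  move=> ht ld; have t0 : 0 < t by case/orP: ht => /eqP ->.
  apply: (le_trans (chisq_chernoff d t0)); rewrite lee_fin.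
  have r1 : chernoff_rate t <= 1.
    apply/ltW/chernoff_rate_lt1 => //; rewrite neq_lt.
    by case/orP: ht => /eqP ->; rewrite ?a1 ?b1 ?orbT.
  have r0 := chernoff_rate_gt0 t0.
  apply: (@le_trans _ _ (chernoff_rate t ^+ l)).
    by apply: ler_wiXn2l => //; exact: ltW.
  rewrite lerXn2r ?nnegrE ?(ltW r0)//.
    by rewrite /rho le_max ltW// chernoff_rate_gt0.
  by rewrite /rho le_max; case/orP: ht => /eqP ->; rewrite lexx ?orbT.
pose U d := E a d `|` E a^-1 d.
have sub : F_tails d1 d2 c `<=`
    ((U d1 `*` setT) `|` (setT `*` U d2)).
  move=> p; apply: contraPP => /not_orP[/= n1 n2].
  have {}n1 : ~ U d1 p.1 by move=> h; apply: n1.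
  have {}n2 : ~ U d2 p.2 by move=> h; apply: n2.
  have bnd d (q : R) : (l <= d)%N -> ~ U d q ->
      a^-1 < q / d%:R /\ q / d%:R < a.
    move=> ld; have d0 : 0 < d%:R :> R by rewrite ltr0n (leq_trans l0).
    move=> /not_orP[/negP + /negP]; rewrite /= -!ltNge => h1 h2.
    rewrite ltr_pdivlMr// ltr_pdivrMr//; split.
      by move: h2; rewrite invrK nmulr_rlt0 ?subr_lt0// subr_gt0.
    by move: h1; rewrite pmulr_rlt0 ?subr_gt0// subr_lt0.
  have [x1 x2] := bnd _ _ ld1 n1; have [y1 y2] := bnd _ _ ld2 n2.
  have y0 := lt_trans b0 y1.
  apply/not_orP; rewrite /F_ratio; split; apply/negP; rewrite -ltNge.
    rewrite ltr_pdivlMr// -aa invfM -mulrA; apply: le_lt_trans x1.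
    by rewrite ler_piMr ?ltW// mulrC ltr_pdivrMr// mul1r.
  rewrite ltr_pdivrMr// -aa; apply: (lt_trans x2).
  by rewrite -mulrA ltr_pMr// mulrC -ltr_pdivrMr// mul1r.
have mF := measurable_F_tails d1 d2 c.
have mU d : measurable (U d) by exact: measurableU.
have bU d : (l <= d)%N -> (chisq_prob d (U d) <= (2 * rho ^+ l)%:E)%E.
  move=> ld; apply: (le_trans (measureU2 _ _ _)) => //.
  rewrite mulr_natl mulr2n EFinD; apply: leeD; apply: bd => //; rewrite eqxx ?orbT//.
apply: (@le_trans _ _ (chi2 d1 d2 (U d1 `*` setT) +
    chi2 d1 d2 (setT `*` U d2))%E).
  apply: (le_trans (le_measure _ _ _ sub)); rewrite ?inE//.
    by apply: measurableU; exact: measurableX.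
  by apply: measureU2; exact: measurableX.
have T1 d : chisq_prob d [set: MR] = 1%E by exact: probability_setT.
rewrite !product_measure1E// [X in (_ * X + _)%E]T1 [X in (_ + X * _)%E]T1 mul1e mule1.
have -> : 4 * rho ^+ l = 2 * rho ^+ l + 2 * rho ^+ l by ring.
by rewrite EFinD; apply: leeD; exact: bU.
Qed.
End FDistributionTheory.

(** * Independence *)

Section Independence.
Context {R : realType} {d : measure_display} {T : measurableType d}
  (P : probability T R).

Definition indep_classes (G H : set (set T)) : Prop :=
  forall A B, G A -> H B -> P (A `&` B) = (P A * P B)%E.

Lemma indep_classes_sym G H : indep_classes G H -> indep_classes H G.
Proof. by move=> GH A B HA GB; rewrite setIC GH// muleC. Qed.

(** For fixed [B], the finite measures [A |-> P (A & B)] and [A |-> P B * P A] agree on the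
    pi-system [G], hence on the sigma-algebra it generates. *)
Lemma indep_classes_sigma_l (G H : set (set T)) :
  G `<=` measurable -> H `<=` measurable -> setI_closed G -> G setT ->
  indep_classes G H -> indep_classes <<s G >> H.
Proof.
move=> Gm Hm GI GT GH A B sGA HB.
have mB := Hm _ HB.
pose k : {nonneg R} := NngNum (fine_ge0 (measure_ge0 P B)).
pose m1 : {measure set T -> \bar R} := mrestr P mB.
pose m2 : {measure set T -> \bar R} := mscale k P.
have kE : k%:num%:E = P B by rewrite /k /= fineK// fin_num_measure.
have -> : P (A `&` B) = m1 A by [].
rewrite (@g_sigma_algebra_measure_unique _ _ _ G Gm (fun=> setT) (fun=> GT) _ m1 m2)//.
- by rewrite /m2 /= /mscale /= -/(k%:num) kE muleC.
- by apply/seteqP; split => // x _; exists 0%N.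
- by move=> C GC; rewrite /m1 /m2 /= /mrestr /mscale -/(k%:num) kE GH// muleC.
- by move=> _; rewrite /m1 /= /mrestr ltey_eq fin_num_measure//; exact: measurableI.
Qed.

Lemma indep_classes_sigma (G H : set (set T)) :
  G `<=` measurable -> H `<=` measurable -> setI_closed G -> setI_closed H ->
  G setT -> H setT -> indep_classes G H -> indep_classes <<s G >> <<s H >>.
Proof.
move=> Gm Hm GI HI GT HT GH.
have sGm : <<s G >> `<=` measurable.
  by apply: smallest_sub => //; exact: sigma_algebra_measurable.
apply/indep_classes_sym/indep_classes_sigma_l => //.
exact/indep_classes_sym/indep_classes_sigma_l.
Qed.

(** The image of [P] under [(U, V)] agrees with the product measure on rectangles, which determine
    it. *)
Lemma joint_law_of_indep d1 d2 (S1 : measurableType d1) (S2 : measurableType d2)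
    (m1 : probability S1 R) (m2 : probability S2 R) (U : T -> S1) (V : T -> S2) :
  measurable_fun setT U -> measurable_fun setT V ->
  (forall A, measurable A -> P (U @^-1` A) = m1 A) ->
  (forall B, measurable B -> P (V @^-1` B) = m2 B) ->
  (forall A B, measurable A -> measurable B ->
    P (U @^-1` A `&` V @^-1` B) = (P (U @^-1` A) * P (V @^-1` B))%E) ->
  forall C, measurable C -> P [set w | C (U w, V w)] = (m1 \x m2)%E C.
Proof.
move=> mU mV lU lV ind C mC.
have mUV : measurable_fun setT (fun w => (U w, V w)) by exact: measurable_fun_pair.
pose m : {measure set (S1 * S2) -> \bar R} := pushforward P (fun w => (U w, V w)).
rewrite (@product_measure_unique _ _ _ _ _ m1 m2 (m mUV))//.
by move=> A B mA mB; have := ind A B mA mB; rewrite lU// lV//.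
Qed.

Context {I : choiceType} (Z : I -> {RV P >-> R}).

(** A pi-system generating the sigma-algebra of the variables indexed by [J], in the very form in
    which mutual independence is stated. *)
Definition cylinders (J : seq I) : set (set T) :=
  [set E | exists A : I -> set R, (forall i, measurable (A i)) /\
     E = \bigcap_(i in [set` J]) (Z i @^-1` A i)].

Lemma measurable_RV_preimage i (A : set R) : measurable A -> measurable (Z i @^-1` A).
Proof. by move=> mA; exact: measurable_funPTI. Qed.

Lemma cylinders_measurable J : cylinders J `<=` measurable.
Proof.
move=> _ [A [mA ->]]; apply: fin_bigcap_measurable => // i _.
exact: measurable_RV_preimage.
Qed.

Lemma cylindersT J : cylinders J setT.
Proof.
exists (fun=> setT); split => //.
by apply/seteqP; split => w.
Qed.

Lemma cylinders_setI J : setI_closed (cylinders J).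
Proof.
move=> _ _ [A [mA ->]] [B [mB ->]]; exists (fun i => A i `&` B i); split.
  by move=> i; exact: measurableI.
by rewrite -bigcapI.
Qed.

(** As [J] and [K] are disjoint, the two families of sets glue to one family over [J ++ K], to which
    mutual independence applies. *)
Lemma cylinders_indep (J K : seq I) : mutually_independent Z -> uniq (J ++ K) ->
  indep_classes (cylinders J) (cylinders K).
Proof.
move=> indZ uJK _ _ [A [mA ->]] [B [mB ->]].
move: (uJK); rewrite cat_uniq => /and3P[uJ /hasPn JK uK].
pose C i := if i \in J then A i else B i.
have mC i : measurable (C i) by rewrite /C; case: ifP.
have CJ i : i \in J -> C i = A i by rewrite /C => ->.
have CK i : i \in K -> C i = B i by move=> /JK; rewrite /C => /negbTE ->.
have -> : \bigcap_(i in [set` J]) Z i @^-1` A i `&` \bigcap_(i in [set` K]) Z i @^-1` B i =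
    \bigcap_(i in [set` (J ++ K)]) Z i @^-1` C i.
  apply/seteqP; split => w.
    move=> [wA wB] i /=; rewrite mem_cat => /orP[iJ|iK].
      by rewrite CJ//; exact: wA.
    by rewrite CK//; exact: wB.
  move=> wC; split => i /= iJ.
    by rewrite -CJ//; apply: wC; rewrite /= mem_cat iJ.
  by rewrite -CK//; apply: wC; rewrite /= mem_cat iJ orbT.
rewrite indZ// big_cat /= (indZ J A)// (indZ K B)//.
by congr (_ * _)%E; apply: eq_big_seq => i iJ; [rewrite CJ|rewrite CK].
Qed.

Lemma cylinders_sigma_measurable J : <<s cylinders J >> `<=` measurable.
Proof.
apply: smallest_sub; first exact: sigma_algebra_measurable.
exact: cylinders_measurable.
Qed.

(** [T] with a smaller sigma-algebra: measurability from [sigma_of J] expresses that a statistic is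
    determined by the observations indexed by [J]. *)
Definition sigma_of (J : seq I) := g_sigma_algebraType (cylinders J).

Lemma sigma_of_measurable d1 (S1 : measurableType d1) J (f : T -> S1) :
  measurable_fun setT (f : sigma_of J -> S1) -> measurable_fun setT f.
Proof.
move=> mf _ A mA; have := mf measurableT A mA.
by rewrite !setTI => /cylinders_sigma_measurable.
Qed.

Lemma sigma_of_indep d1 d2 (S1 : measurableType d1) (S2 : measurableType d2)
    J K (f : T -> S1) (g : T -> S2) :
  mutually_independent Z -> uniq (J ++ K) ->
  measurable_fun setT (f : sigma_of J -> S1) ->
  measurable_fun setT (g : sigma_of K -> S2) ->
  forall A B, measurable A -> measurable B ->
    P (f @^-1` A `&` g @^-1` B) = (P (f @^-1` A) * P (g @^-1` B))%E.
Proof.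
move=> indZ uJK mf mg A B mA mB.
apply: (@indep_classes_sigma (cylinders J) (cylinders K)).
- exact: cylinders_measurable.
- exact: cylinders_measurable.
- exact: cylinders_setI.
- exact: cylinders_setI.
- exact: cylindersT.
- exact: cylindersT.
- exact: cylinders_indep.
- by have := mf measurableT A mA; rewrite setTI.
- by have := mg measurableT B mB; rewrite setTI.
Qed.

Lemma sigma_of_RV J i : i \in J ->
  measurable_fun setT (Z i : sigma_of J -> measurableTypeR R).
Proof.
move=> iJ _ A mA; rewrite setTI; apply: sub_sigma_algebra.
exists (fun j => if j == i then A else setT); split.
  by move=> j; case: ifP.
apply/seteqP; split => w /=.
  by move=> wA j _ /=; case: eqP => // ->.
by move=> /(_ i iJ); rewrite eqxx.
Qed.

End Independence.

(** * The law of the sample variances *)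

Section Helmert.
Context {R : realType}.
Local Notation MR := (measurableTypeR R).
Local Notation N01 := (normal_prob (0 : R) 1).

(** For a fixed chi-square coordinate [q], the normalized sum and the new observation form a
    standard normal pair, so rotating them changes nothing. Adding the square of one rotated
    coordinate to [q] is the recursive step of [chisq_prob], and the other coordinate stays
    independent of the result. *)
Lemma helmert_step n (c s : R) (A : set (MR * MR)) : 0 < c ->
  c ^+ 2 + s ^+ 2 = 1 -> measurable A ->
  ((N01 \x chisq_prob n) \x N01)%E [set p | A (c * p.1.1 + s * p.2,
     (c * p.2 - s * p.1.1) ^+ 2 + p.1.2)] = (N01 \x chisq_prob n.+1)%E A.
Proof.
move=> c0 cs mA.
pose NC : probability (MR * MR)%type R := (N01 \x chisq_prob n)%E.
pose NN : probability (MR * MR)%type R := (N01 \x N01)%E.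
pose f (q : MR) (p : MR * MR) : \bar R := (\1_A (p.1, p.2 ^+ 2 + q)%R)%:E.
have f0 q p : (0 <= f q p)%E by rewrite lee_fin.
have mf2 : measurable_fun setT (fun p : (MR * MR) * MR => f p.2 p.1).
  apply/measurable_EFinP; apply: (measurableT_comp (measurable_indic mA)).
  apply: measurable_fun_pair.
    by apply: (measurableT_comp measurable_fst); exact: measurable_fst.
  apply: measurable_funD; last exact: measurable_snd.
  apply: measurable_funX.
  by apply: (measurableT_comp measurable_snd); exact: measurable_fst.
have mfq q : measurable_fun setT (f q).
  exact: (measurable_fun_pair1 _ mf2).
pose rot (p : MR * MR) : MR * MR := (c * p.1 + s * p.2, c * p.2 - s * p.1).
have mrot : measurable_fun setT rot.
  apply: measurable_fun_pair.
    apply: measurable_funD; apply: measurable_funM => //.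
  apply: measurable_funB; apply: measurable_funM => //.
pose g (p : (MR * MR) * MR) : \bar R := f p.1.2 (rot (p.1.1, p.2)).
have mg : measurable_fun setT g.
  have mh : measurable_fun setT (fun p : (MR * MR) * MR => (rot (p.1.1, p.2), p.1.2)).
    apply: measurable_fun_pair.
      apply: (measurableT_comp mrot); apply: measurable_fun_pair => //.
      by apply: (measurableT_comp measurable_fst); exact: measurable_fst.
    by apply: (measurableT_comp measurable_snd); exact: measurable_fst.
  exact: (measurableT_comp mf2 mh).
have g0 p : (0 <= g p)%E by exact: f0.
transitivity (\int[(N01 \x chisq_prob n) \x N01]_p g p)%E.
  set B := [set p | _].
  have mB : measurable B.
    have -> : B = g @^-1` [set 1%E].
      apply/seteqP; split => p; rewrite /B /g /f /rot /= indicE.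
        by move=> Bp; rewrite mem_set.
      by have [/set_mem//|_ [] /eqP] := boolP (_ \in A); rewrite eq_sym oner_eq0.
    by rewrite -[X in measurable X]setTI; exact: mg.
  rewrite -[X in product_measure1 _ _ X]setIT -integral_indic//.
pose G (p : MR * MR) : \bar R := (\int[N01]_z g (p, z))%E.
have mG : measurable_fun setT G by exact: measurable_fun_fubini_tonelli_F.
have G0 p : (0 <= G p)%E by exact: integral_ge0.
have mgq q : measurable_fun setT (fun p => g ((p.1, q), p.2)).
  apply: (measurableT_comp mg); apply: measurable_fun_pair => //.
  by apply: measurable_fun_pair => //; exact: measurable_fst.
(* Integrating over [q] last lets the rotation act for each [q] separately; afterwards the order is
   changed back so that [q] combines with the squared coordinate. *)
transitivity (\int[chisq_prob n]_q \int[N01 \x N01]_p f q p)%E.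
  apply: (eq_trans (fubini_tonelli1 (m1 := NC) (m2 := N01) g mg g0)).
  apply: (eq_trans (fubini_tonelli2 (m1 := N01) (m2 := chisq_prob n) G mG G0)).
  apply: eq_integral => q _.
  rewrite -(ge0_integral_normal_rotation c0 cs (mfq q) (f0 q)).
  apply: esym.
  exact: (fubini_tonelli1 (m1 := N01) (m2 := N01) (fun p => g ((p.1, q), p.2)) (mgq q)).
have mA1 : measurable_fun setT (fun p => (\1_A p)%:E : \bar R).
  by apply/measurable_EFinP; exact: measurable_indic.
rewrite -[X in product_measure1 _ _ X]setIT -integral_indic//.
have A0 p : (0 <= (\1_A p)%:E :> \bar R)%E by rewrite lee_fin.
have f20 (p : (MR * MR) * MR) : (0 <= f p.2 p.1)%E by exact: f0.
rewrite -(fubini_tonelli (m1 := NN) (m2 := chisq_prob n) (fun p => f p.2 p.1) mf2 f20).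
have mF : measurable_fun setT (fun p : MR * MR => \int[chisq_prob n]_q f q p)%E.
  exact: (measurable_fun_fubini_tonelli_F (fun p : (MR * MR) * MR => f p.2 p.1)).
apply: (eq_trans (fubini_tonelli1 (m1 := N01) (m2 := N01) (fun p => \int[chisq_prob n]_q f q p)%E mF _)).
  by move=> p; exact: integral_ge0.
apply: (eq_trans _ (esym (fubini_tonelli1 (m1 := N01) (m2 := chisq_prob n.+1) _ mA1 A0))).
apply: eq_integral => u _.
rewrite /fubini_F [RHS]ge0_integral_chisqS//.
exact: (measurable_fun_pair2 u mA1).
Qed.
End Helmert.

(** * Algebra and measurability of the sample statistics *)

Section SampleStatistics.
Context {R : realType}.
Implicit Types (x : nat -> R) (n : nat).

(** Normalized so as to be standard normal when the observations are independent standard normal and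
    [n] is positive. *)
Definition scaled_sum x n : R := (\sum_(k < n) x k) / Num.sqrt n%:R.

Lemma sum_sq_devE x n : (0 < n)%N ->
  sum_sq_dev x n = \sum_(k < n) x k ^+ 2 - (\sum_(k < n) x k) ^+ 2 / n%:R.
Proof.
move=> n0; rewrite /sum_sq_dev /sample_mean; set S := \sum_(k < n) x k.
have n_ne0 : n%:R != 0 :> R by rewrite pnatr_eq0 -lt0n.
transitivity (\sum_(k < n) (x k ^+ 2 - 2 * (S / n%:R) * x k + (S / n%:R) ^+ 2)).
  by apply: eq_bigr => k _; ring.
rewrite big_split sumrB /= -mulr_sumr -/S sumr_const card_ord -mulr_natr.
by field.
Qed.

(** First coordinate of the rotation with cosine [sqrt n / sqrt n.+1] and sine [1 / sqrt n.+1];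
    [sum_sq_devS] supplies the square of the second one. *)
Lemma scaled_sumS x n : (0 < n)%N ->
  scaled_sum x n.+1 = Num.sqrt n%:R / Num.sqrt n.+1%:R * scaled_sum x n
    + (Num.sqrt n.+1%:R)^-1 * x n.
Proof.
move=> n0; rewrite /scaled_sum big_ord_recr /=.
have r0 : Num.sqrt n%:R != 0 :> R by rewrite gt_eqF// sqrtr_gt0 ltr0n.
have r1 : Num.sqrt n.+1%:R != 0 :> R by rewrite gt_eqF// sqrtr_gt0 ltr0n.
by field; rewrite r0 r1.
Qed.

Lemma sum_sq_devS x n : (0 < n)%N ->
  sum_sq_dev x n.+1 = (Num.sqrt n%:R / Num.sqrt n.+1%:R * x n
    - (Num.sqrt n.+1%:R)^-1 * scaled_sum x n) ^+ 2 + sum_sq_dev x n.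
Proof.
move=> n0; rewrite !sum_sq_devE// /scaled_sum !big_ord_recr /=.
set S := \sum_(k < n) x k; set Q := \sum_(k < n) x k ^+ 2.
set r := Num.sqrt n%:R; set t := Num.sqrt n.+1%:R.
have r0 : r != 0 by rewrite gt_eqF// sqrtr_gt0 ltr0n.
have t0 : t != 0 by rewrite gt_eqF// sqrtr_gt0 ltr0n.
have rr : n%:R = r ^+ 2 by rewrite sqr_sqrtr.
have tt : n.+1%:R = t ^+ 2 by rewrite sqr_sqrtr.
have tr : t ^+ 2 = r ^+ 2 + 1 by rewrite -rr -tt -natr1.
rewrite rr tt.
have -> : (r / t * x n - t^-1 * (S / r)) ^+ 2 = (r ^+ 2 * x n - S) ^+ 2 / (t ^+ 2 * r ^+ 2).
  by field; rewrite r0 t0.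
have t2 : r ^+ 2 + 1 != 0 by rewrite -tr expf_neq0.
rewrite tr; field.
by rewrite r0 t2.
Qed.

Lemma sum_sq_dev_affine x (a b : R) n : (0 < n)%N ->
  sum_sq_dev (fun k => (x k - a) / b) n = sum_sq_dev x n / b ^+ 2.
Proof.
move=> n0; have n_ne0 : n%:R != 0 :> R by rewrite pnatr_eq0 -lt0n.
have mE : sample_mean (fun k => (x k - a) / b) n = (sample_mean x n - a) / b.
  rewrite /sample_mean -mulr_suml sumrB sumr_const card_ord -[a *+ n]mulr_natr.
  by rewrite mulrAC mulrBl mulfK.
rewrite /sum_sq_dev mE mulr_suml; apply: eq_bigr => k _.
by rewrite -exprVn -exprMn; congr (_ ^+ 2); ring.
Qed.

Lemma sum_sq_dev_ge0 x n : 0 <= sum_sq_dev x n.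
Proof. by apply: sumr_ge0 => k _; rewrite sqr_ge0. Qed.

Lemma sum_sq_dev1 x : sum_sq_dev x 1 = 0.
Proof. by rewrite /sum_sq_dev big_ord1 /sample_mean big_ord1 divr1 subrr expr0n. Qed.

Context {d : measure_display} {T : measurableType d}.
Implicit Types z : nat -> T -> measurableTypeR R.

Lemma measurable_sum_ord n (h : 'I_n -> T -> R) :
  (forall k, measurable_fun setT (h k)) -> measurable_fun setT (fun w => \sum_(k < n) h k w).
Proof.
move=> mh; have -> : (fun w => \sum_(k < n) h k w) = fun w => \sum_(k <- enum 'I_n) h k w.
  by apply/funext => w; rewrite big_enum.
exact: measurable_sum.
Qed.

Lemma measurable_scaled_sum z n : (forall k, (k < n)%N -> measurable_fun setT (z k)) ->
  measurable_fun setT (fun w => scaled_sum (z^~ w) n : measurableTypeR R).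
Proof.
move=> mz; apply: measurable_funM => //.
by apply: (@measurable_sum_ord n (fun k => z k)) => i; exact: mz.
Qed.

Lemma measurable_sum_sq_dev z n : (forall k, (k < n)%N -> measurable_fun setT (z k)) ->
  measurable_fun setT (fun w => sum_sq_dev (z^~ w) n : measurableTypeR R).
Proof.
move=> mz; apply: measurable_sum_ord => k; apply: measurable_funX.
apply: measurable_funB; first exact: mz.
apply: measurable_funM => //.
by apply: (@measurable_sum_ord n (fun k => z k)) => i; exact: mz.
Qed.
End SampleStatistics.

(** * Joint law of the normalized sum and the sum of squared deviations *)

Section NormalSample.
Context {R : realType} {d : measure_display} {T : measurableType d}
  (P : probability T R).
Local Notation MR := (measurableTypeR R).
Local Notation N01 := (normal_prob (0 : R) 1).

(** Induction on the sample size, each new observation acting through [helmert_step]. One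
    observation has deviation 0, which matches the Dirac mass [chisq_prob 0]: [n.+1] observations
    give [n] degrees of freedom. *)
Lemma scaled_sum_sum_sq_dev_law (z : nat -> T -> MR) :
  (forall k, measurable_fun setT (z k)) ->
  (forall k A, measurable A -> P (z k @^-1` A) = N01 A) ->
  (forall n (A : set (MR * MR)) (B : set MR), measurable A -> measurable B ->
     P ([set w | A (scaled_sum (z^~ w) n, sum_sq_dev (z^~ w) n)] `&` z n @^-1` B) =
     (P [set w | A (scaled_sum (z^~ w) n, sum_sq_dev (z^~ w) n)] * P (z n @^-1` B))%E) ->
  forall n (A : set (MR * MR)), measurable A ->
    P [set w | A (scaled_sum (z^~ w) n.+1, sum_sq_dev (z^~ w) n.+1)] =
    (N01 \x chisq_prob n)%E A.
Proof.
move=> mz lz iz; elim=> [|n IH] A mA.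
  have -> : [set w | A (scaled_sum (z^~ w) 1, sum_sq_dev (z^~ w) 1)] =
      [set w | A (z 0%N w, 0)].
    by apply/seteqP; split => w /=; rewrite /scaled_sum big_ord1 sqrtr1 divr1 sum_sq_dev1.
  apply: (@joint_law_of_indep _ _ _ P _ _ MR MR N01 (chisq_prob 0) (z 0%N) (fun=> 0)) => //.
  - exact: lz.
  - move=> B mB /=; have [B0|B0] := pselect (B 0).
      rewrite diracE mem_set//= (_ : _ @^-1` _ = setT) ?probability_setT//.
      by apply/seteqP; split.
    rewrite diracE memNset//= (_ : _ @^-1` _ = set0) ?measure0//.
    by apply/seteqP; split.
  - move=> C B mC mB; have [B0|B0] := pselect (B 0).
      rewrite (_ : _ @^-1` B = setT) ?setIT ?probability_setT ?mule1//.
      by apply/seteqP; split.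
    rewrite (_ : _ @^-1` B = set0) ?setI0 ?measure0 ?mule0//.
    by apply/seteqP; split.
pose c : R := Num.sqrt n.+1%:R / Num.sqrt n.+2%:R.
pose s : R := (Num.sqrt n.+2%:R)^-1.
have c0 : 0 < c by rewrite divr_gt0 ?sqrtr_gt0.
have cs : c ^+ 2 + s ^+ 2 = 1.
  rewrite /c /s exprMn exprVn !sqr_sqrtr//.
  have n0 : n.+2%:R != 0 :> R by rewrite pnatr_eq0.
  by rewrite -[X in _ + X]mul1r -mulrDl natr1 divff.
pose W w := (scaled_sum (z^~ w) n.+1, sum_sq_dev (z^~ w) n.+1).
pose NC : probability (MR * MR)%type R := (N01 \x chisq_prob n)%E.
pose B := [set p : (MR * MR) * MR | A (c * p.1.1 + s * p.2,
     (c * p.2 - s * p.1.1) ^+ 2 + p.1.2)].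
have mB : measurable B.
  have mg : measurable_fun setT (fun p : (MR * MR) * MR => (c * p.1.1 + s * p.2,
     (c * p.2 - s * p.1.1) ^+ 2 + p.1.2) : MR * MR).
    have m11 : measurable_fun setT (fun p : (MR * MR) * MR => p.1.1).
      by apply: (measurableT_comp measurable_fst); exact: measurable_fst.
    have m12 : measurable_fun setT (fun p : (MR * MR) * MR => p.1.2).
      by apply: (measurableT_comp measurable_snd); exact: measurable_fst.
    apply: measurable_fun_pair.
      by apply: measurable_funD; apply: measurable_funM.
    apply: measurable_funD => //; apply: measurable_funX.
    by apply: measurable_funB; apply: measurable_funM.
  by have := mg measurableT A mA; rewrite setTI.
rewrite -(helmert_step n c0 cs mA).
have mW : measurable_fun setT (W : T -> MR * MR).
  apply: measurable_fun_pair; first exact: measurable_scaled_sum.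
  exact: measurable_sum_sq_dev.
rewrite -(joint_law_of_indep (m1 := NC) mW (mz n.+1) IH (lz n.+1) (iz n.+1) mB).
by congr (P _); apply/seteqP; split => w; rewrite /B /W /= (scaled_sumS _ (ltn0Sn n)) (sum_sq_devS _ (ltn0Sn n)).
Qed.
End NormalSample.

(** * The two samples and the variance ratio *)

Section SampleVariance.
Context {R : realType} {d : measure_display} {T : measurableType d}
  (P : probability T R).
Local Notation MR := (measurableTypeR R).
Local Notation N01 := (normal_prob (0 : R) 1).

Lemma sigma_of_standardized (I : choiceType) (Z : I -> {RV P >-> R}) (J : seq I)
    (i : I) (mu s : R) : i \in J ->
  measurable_fun setT ((fun w => (Z i w - mu) / s) : sigma_of Z J -> MR).
Proof.
move=> iJ; apply: measurable_funM => //; apply: measurable_funB => //.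
exact: (sigma_of_RV iJ).
Qed.

(** The map [e] selects one sample out of a larger independent family, so that the same lemma serves
    [X] and [Y]. Its injectivity keeps observation [m] outside the first [m] ones. *)
Lemma sum_sq_dev_law (I : choiceType) (Z : I -> {RV P >-> R}) (e : nat -> I)
    (mu s : R) n (B : set MR) :
  mutually_independent Z -> injective e -> 0 < s ->
  (forall k, normally_distributed mu s (Z (e k))) -> measurable B ->
  P [set w | B (sum_sq_dev (fun k => (Z (e k) w - mu) / s) n.+1)] = chisq_prob n B.
Proof.
move=> indZ inj_e s0 lawZ mB.
pose z k w : MR := (Z (e k) w - mu) / s.
have mz k : measurable_fun setT (z k).
  apply: (@sigma_of_measurable _ _ _ P _ Z _ _ [:: e k]).
  by apply: sigma_of_standardized; rewrite mem_head.
have lz k A : measurable A -> P (z k @^-1` A) = N01 A.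
  move=> mA; rewrite -(normal_prob_standardize mu s0 mA) -(lawZ k)//.
  have mh : measurable_fun setT (fun x : MR => (x - mu) / s : MR).
    by apply: measurable_funM => //; apply: measurable_funB.
  by have := mh measurableT A mA; rewrite setTI.
have iz m (A : set (MR * MR)) (C : set MR) : measurable A -> measurable C ->
    P ([set w | A (scaled_sum (z^~ w) m, sum_sq_dev (z^~ w) m)] `&` z m @^-1` C) =
    (P [set w | A (scaled_sum (z^~ w) m, sum_sq_dev (z^~ w) m)] * P (z m @^-1` C))%E.
  move=> mA mC.
  pose J := [seq e k | k <- iota 0 m].
  have mzJ k : (k < m)%N -> measurable_fun setT (z k : sigma_of Z J -> MR).
    by move=> km; apply: sigma_of_standardized; rewrite map_f// mem_iota.
  apply: (@sigma_of_indep _ _ _ P _ Z _ _ (MR * MR)%type MR J [:: e m]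
    (fun w => (scaled_sum (z^~ w) m, sum_sq_dev (z^~ w) m)) (z m)) => //.
  - rewrite cat_uniq map_inj_uniq// iota_uniq /= orbF andbT.
    by apply/mapP => -[k]; rewrite mem_iota /= add0n => km /inj_e mk; rewrite mk ltnn in km.
  - apply: measurable_fun_pair; first exact: (@measurable_scaled_sum _ _ (sigma_of Z J)).
    exact: (@measurable_sum_sq_dev _ _ (sigma_of Z J)).
  - by apply: sigma_of_standardized; rewrite mem_head.
(* The marginal law of the second statistic is read off the joint law on [setT] times [B]. *)
have mTB : measurable ([set: MR] `*` B) by exact: measurableX.
have := scaled_sum_sum_sq_dev_law mz lz iz n mTB.
rewrite product_measure1E// [X in (X * _)%E](_ : _ = 1%E) ?mul1e; last exact: probability_setT.
move=> <-; congr (P _); apply/seteqP; split => w /=; first by split.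
by case.
Qed.

Variables (X Y : nat -> {RV P >-> R}) (muX sigmaX muY sigmaY : R).
Hypotheses (sX0 : 0 < sigmaX) (sY0 : 0 < sigmaY).
Hypothesis samp : normal_samples muX sigmaX muY sigmaY X Y.

(** The two sums are measurable for disjoint blocks [JX] and [JY] of the pooled family, hence
    independent, and each has its chi-square law. *)
Lemma sum_sq_dev_pair_law nx ny (C : set (MR * MR)) : measurable C ->
  P [set w | C (sum_sq_dev (X^~ w) nx.+1 / sigmaX ^+ 2,
                sum_sq_dev (Y^~ w) ny.+1 / sigmaY ^+ 2)] =
  (chisq_prob nx \x chisq_prob ny)%E C.
Proof.
case: samp => lX lY ind mC.
pose Z := pooled X Y.
pose JX := [seq inl k : (nat + nat)%type | k <- iota 0 nx.+1].
pose JY := [seq inr k : (nat + nat)%type | k <- iota 0 ny.+1].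
pose zX k w : MR := (X k w - muX) / sigmaX.
pose zY k w : MR := (Y k w - muY) / sigmaY.
have mX : measurable_fun setT ((fun w => sum_sq_dev (zX^~ w) nx.+1) : sigma_of Z JX -> MR).
  apply: (@measurable_sum_sq_dev _ _ (sigma_of Z JX)) => k kn.
  by apply: (@sigma_of_standardized _ Z JX (inl k)); rewrite map_f// mem_iota.
have mY : measurable_fun setT ((fun w => sum_sq_dev (zY^~ w) ny.+1) : sigma_of Z JY -> MR).
  apply: (@measurable_sum_sq_dev _ _ (sigma_of Z JY)) => k kn.
  by apply: (@sigma_of_standardized _ Z JY (inr k)); rewrite map_f// mem_iota.
have lawX (A : set MR) : measurable A ->
    P [set w | A (sum_sq_dev (zX^~ w) nx.+1)] = chisq_prob nx A.
  by move=> mA; apply: (@sum_sq_dev_law _ Z inl) => // i j [].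
have lawY (A : set MR) : measurable A ->
    P [set w | A (sum_sq_dev (zY^~ w) ny.+1)] = chisq_prob ny A.
  by move=> mA; apply: (@sum_sq_dev_law _ Z inr) => // i j [].
have uJ : uniq (JX ++ JY).
  rewrite cat_uniq; apply/and3P; split.
  - by rewrite map_inj_uniq ?iota_uniq// => i j [].
  - by apply/hasPn => _ /mapP[k _ ->]; apply/mapP => -[].
  - by rewrite map_inj_uniq ?iota_uniq// => i j [].
rewrite -(joint_law_of_indep (sigma_of_measurable mX) (sigma_of_measurable mY)
  lawX lawY (sigma_of_indep ind uJ mX mY) mC).
congr (P _); apply/seteqP; split => w /=; rewrite /zX /zY !sum_sq_dev_affine//.
Qed.

Lemma theta_hatE (x y : nat -> R) nx ny :
  theta_hat x y nx.+1 ny.+1 = sigmaX ^+ 2 / sigmaY ^+ 2 *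
    F_ratio nx ny (sum_sq_dev x nx.+1 / sigmaX ^+ 2, sum_sq_dev y ny.+1 / sigmaY ^+ 2).
Proof.
rewrite /theta_hat /F_ratio /=.
set A := sum_sq_dev x _; set B := sum_sq_dev y _.
have x0 : sigmaX != 0 by rewrite gt_eqF.
have y0 : sigmaY != 0 by rewrite gt_eqF.
rewrite !invfM !invrK /=.
(* The identity is polynomial in these two inverses; as plain variables they may also take the
   default value [0^-1 = 0]. *)
move: (B^-1) (nx%:R^-1) => iB inx.
by field; rewrite x0 y0.
Qed.

End SampleVariance.

(** * Error bounds at a single stage *)

Section StageBound.
Context {R : realType}.
Local Notation MR := (measurableTypeR R).
Local Notation chi2 d1 d2 := (chisq_prob d1 \x chisq_prob d2)%E.

Section OneThreshold.
Variables (t' t'' : R) (t'_gt0 : 0 < t') (t't'' : t' < t'').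
(** In units of [t'] the indifference zone is [[1, r]]. The point [r * y] lies three quarters of the
    way from 1 to [r], and [x = (1 + r * y) / 2] is the midpoint of [t' * u] and [t'' * v] at
    [u = 1], [v = y]. Conversely, for [u <= x] and [v <= 1] the midpoint is at most
    [(x + r) / 2 <= r * y]. The neighbourhood of 1 bounded by [c^-1] and [c] satisfies [c <= x] and
    [y <= c^-1], as both estimates require. *)
Let r := t'' / t'.
Let x := (3 * r + 5) / 8.
Let y := (3 * r + 1) / (4 * r).
Let c := Num.min x y^-1.

Let r1 : 1 < r. Proof. by rewrite ltr_pdivlMr// mul1r. Qed.
Let r0 : 0 < r. Proof. exact: lt_trans r1. Qed.
Let y0 : 0 < y. Proof. by apply: divr_gt0; have := r0; lra. Qed.
Let t''E : t'' = r * t'. Proof. by rewrite /r mulrAC -mulrA divff ?mulr1// gt_eqF. Qed.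
Let cx : c <= x. Proof. by rewrite ge_min lexx. Qed.
Let yc : y <= c^-1.
Proof.
have c_gt0 : 0 < c by rewrite lt_min invr_gt0 y0 andbT; have := r0; rewrite /x; lra.
by rewrite -[y]invrK lef_pV2 ?posrE ?invr_gt0// ge_min lexx orbT.
Qed.

Lemma separation_gt1 : 1 < c.
Proof.
rewrite lt_min; apply/andP; split; first by have := r1; rewrite /x; lra.
by rewrite invf_gt1// /y ltr_pdivrMr; have := r1; lra.
Qed.

Lemma separation_u (u v : R) : 1 <= u -> c^-1 <= v ->
  c <= Num.max (t' * u) ((t' * u + t'' * v) / 2) / t'.
Proof.
move=> u1 cv; apply: (le_trans cx).
rewrite ler_pdivlMr// le_max; apply/orP; right.
have ry : r * y = (3 * r + 1) / 4 by rewrite /y; field; rewrite gt_eqF.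
have : (3 * r + 1) / 4 <= r * v.
  by rewrite -ry ler_pM2l//; exact: le_trans yc cv.
rewrite t''E => rv.
have : (x * 2) * t' <= (u + r * v) * t' by rewrite ler_pM2r// /x; lra.
by nra.
Qed.

Lemma separation_v (u v : R) : u <= c -> v <= 1 ->
  Num.min (t'' * v) ((t' * u + t'' * v) / 2) / t'' <= c^-1.
Proof.
move=> uc v1; apply: le_trans yc.
have t''0 : 0 < t'' by apply: lt_trans t't''.
rewrite ler_pdivrMr// ge_min; apply/orP; right.
have ry : r * y = (3 * r + 1) / 4 by rewrite /y; field; rewrite gt_eqF.
rewrite t''E mulrA [y * r]mulrC ry.
have ux : u <= x by exact: le_trans uc cx.
have rv : r * v <= r by rewrite -[leRHS]mulr1 ler_pM2l.
have : (u + r * v) * t' <= ((3 * r + 1) / 2) * t'.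
  by rewrite ler_pM2r//; move: ux rv (r1); rewrite /x; lra.
by nra.
Qed.

(** The first two bounds hold because [g / t'] is at least the upper quantile and [f / t''] at most
    the lower one. For the other two, a quantile outside the neighbourhood given by [c] would put
    its whole mass [b] (or [a]) into the tails, so [e < b] forces [c^-1 <= v] and [e < a] forces
    [u <= c]; the separation lemmas then place the crossing event inside the tails. Note the
    exchange: [b] controls the bound on [g], and [a] the one on [f]. *)
Lemma stage_tails_bound nx ny (a b e : R) : (1 < nx)%N -> (1 < ny)%N ->
  0 < a < 1 -> 0 < b < 1 ->
  (chi2 nx.-1 ny.-1 (F_tails nx.-1 ny.-1 c) <= e%:E)%E ->
  let u := u_bound nx ny a in let v := v_bound nx ny b in
  let g := Num.max (t' * u) ((t' * u + t'' * v) / 2) in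
  let f := Num.min (t'' * v) ((t' * u + t'' * v) / 2) in
  [/\ (chi2 nx.-1 ny.-1 (F_gt nx.-1 ny.-1 (g / t')) <= a%:E)%E,
      (chi2 nx.-1 ny.-1 (F_le nx.-1 ny.-1 (f / t'')) <= b%:E)%E,
      e < b -> (chi2 nx.-1 ny.-1 (F_gt nx.-1 ny.-1 (g / t')) <= e%:E)%E &
      e < a -> (chi2 nx.-1 ny.-1 (F_le nx.-1 ny.-1 (f / t'')) <= e%:E)%E].
Proof.
move=> nx1 ny1 a01 b01 he u v g f.
have d1_gt0 : (0 < nx.-1)%N by rewrite -ltnS prednK// ltnW.
have d2_gt0 : (0 < ny.-1)%N by rewrite -ltnS prednK// ltnW.
have t''0 : 0 < t'' by apply: lt_trans t't''.
move: he d1_gt0 d2_gt0; rewrite /g /f /u /v /u_bound /v_bound.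
move: (nx.-1) (ny.-1) => d1 d2 he d1_gt0 d2_gt0.
set qa := F_quantile d1 d2 (1 - a); set qb := F_quantile d1 d2 b.
set u' := Num.max 1 qa; set v' := Num.min 1 qb.
have mono A B : measurable A -> measurable B -> A `<=` B ->
    (chi2 d1 d2 A <= chi2 d1 d2 B)%E.
  by move=> mA mB; apply: le_measure; rewrite inE.
have gt_tails z : c <= z -> F_gt d1 d2 z `<=` F_tails d1 d2 c.
  by move=> cz p /= zp; right; exact: le_trans cz (ltW zp).
have le_tails z : z <= c^-1 -> F_le d1 d2 z `<=` F_tails d1 d2 c.
  by move=> cz p /= zp; left; exact: le_trans zp cz.
have mg z := measurable_F_gt d1 d2 z.
have ml z := measurable_F_le d1 d2 z.
have mt := measurable_F_tails d1 d2 c.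
have Eb : chi2 d1 d2 (F_le d1 d2 qb) = b%:E by exact: F_quantileE.
split.
- rewrite -(F_gt_quantile d1_gt0 d2_gt0 a01); apply: (mono _ _) => // p /=; apply: le_lt_trans.
  apply: (@le_trans _ _ u'); first by rewrite le_max lexx orbT.
  by rewrite ler_pdivlMr// mulrC le_max lexx.
- rewrite -Eb; apply: (mono _ _) => // p /= /le_trans; apply.
  apply: (@le_trans _ _ v'); last by rewrite ge_min lexx orbT.
  by rewrite ler_pdivrMr// [v' * _]mulrC ge_min lexx.
- move=> eb; apply: (le_trans _ he); apply: (mono _ _) => //; apply: (gt_tails _).
  apply: separation_u; first by rewrite le_max lexx.
  rewrite le_min invf_le1 ?(lt_trans ltr01 separation_gt1)// (ltW separation_gt1) /=.
  rewrite leNgt; apply/negP => qc.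
  have : (b%:E <= e%:E)%E.
    rewrite -Eb; apply: (le_trans _ he).
    by apply: (mono _ _) => //; apply: (le_tails _); exact: ltW.
  by rewrite lee_fin leNgt eb.
- move=> ea; apply: (le_trans _ he); apply: (mono _ _) => //; apply: (le_tails _).
  apply: separation_v; last by rewrite ge_min lexx.
  rewrite ge_max (ltW separation_gt1) /= leNgt; apply/negP => qc.
  have : (a%:E <= e%:E)%E.
    rewrite -(F_gt_quantile d1_gt0 d2_gt0 a01); apply: (le_trans _ he).
    by apply: (mono _ _) => //; apply: (gt_tails _); exact: ltW.
  by rewrite lee_fin leNgt ea.
Qed.

End OneThreshold.
End StageBound.

(** * Stage bounds summable uniformly in the number of stages *)

Section Asymptotics.
Context {R : realType}.
Local Notation chi2 d1 d2 := (chisq_prob d1 \x chisq_prob d2)%E.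

Lemma geometric_sum_le (t : R) s : 0 < t < 1 ->
  \sum_(l < s) t ^+ l.+1 <= (1 - t)^-1.
Proof.
move=> /andP[t0 t1]; have t1' : 0 < 1 - t by rewrite subr_gt0.
rewrite -(ler_pM2r t1') mulVf ?gt_eqF//.
have -> : (\sum_(l < s) t ^+ l.+1) * (1 - t) = t - t ^+ s.+1.
  elim: s => [|s IH]; first by rewrite big_ord0 mul0r expr1 subrr.
  by rewrite big_ord_recr /= mulrDl IH !exprS; ring.
have : 0 <= t ^+ s.+1 by rewrite exprn_ge0// ltW.
lra.
Qed.

(* Used with [E = 2 tau^l] and [w = sqrt zeta]: up to a constant, the smaller of [w ^ 2] and
   [E ^ 2] is at most [w * E], which is summable in [l] and vanishes with [zeta]. *)
Lemma interpolated_bound (p E q w B0 : R) : 0 < E -> 0 < q -> 0 < w -> 0 < B0 ->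
  p <= B0 * w ^+ 2 -> (E ^+ 2 <= (q * w) ^+ 2 -> p <= E ^+ 2) ->
  p <= (q + B0 / q) * w * E.
Proof.
move=> E0 q0 w0 B00 pB pE.
have qw0 : 0 < q * w by rewrite mulr_gt0.
have BqE : 0 < B0 / q * w * E by rewrite !mulr_gt0// invr_gt0.
have qwE : 0 < q * w * E by rewrite !mulr_gt0.
(* Each summand of the constant serves one case: [E ^+ 2 <= q * w * E] if [E <= q * w], and
   [B0 * w ^+ 2 = B0 / q * w * (q * w)] is below the other term if not. *)
rewrite !mulrDl; have [Eqw|qwlE] := leP E (q * w).
  have : E ^+ 2 <= (q * w) ^+ 2 by rewrite lerXn2r// nnegrE ltW.
  move=> /pE; have : E ^+ 2 <= q * w * E by rewrite expr2 ler_pM2r.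
  lra.
have : B0 * w ^+ 2 <= B0 / q * w * E.
  have -> : B0 * w ^+ 2 = B0 / q * w * (q * w) by field; rewrite gt_eqF.
  by rewrite ler_pM2l ?ltW// mulr_gt0// divr_gt0.
lra.
Qed.

(** [stage_g] and [stage_f] are convertible to [g_bound] and [f_bound] at a single threshold, with
    numbers in place of sequences. *)
Definition stage_g (t' t'' a b : R) (nx ny : nat) :=
  let u := u_bound nx ny a in let v := v_bound nx ny b in
  Num.max (t' * u) ((t' * u + t'' * v) / 2).

Definition stage_f (t' t'' a b : R) (nx ny : nat) :=
  let u := u_bound nx ny a in let v := v_bound nx ny b in
  Num.min (t'' * v) ((t' * u + t'' * v) / 2).

(** The sequence [b] is chosen before the number of stages and the sample sizes, which may therefore
    vary with [z] at will. Index [l] stands for stage [l.+1]. *)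
Lemma zeta_stage_bound (t' t'' : R) (alpha beta : R -> R) (eps : R) :
  0 < t' -> t' < t'' -> order_zeta alpha -> order_zeta beta ->
  (forall z, 0 < z -> 0 < alpha z < 1) -> (forall z, 0 < z -> 0 < beta z < 1) ->
  0 < eps ->
  \forall z \near 0^'+, exists b : nat -> R,
    (forall s, \sum_(l < s) b l <= eps) /\
    forall l nx ny, (l.+1 < nx)%N -> (l.+1 < ny)%N ->
      (chi2 nx.-1 ny.-1 (F_gt nx.-1 ny.-1 (stage_g t' t'' (alpha z) (beta z) nx ny / t'))
         <= (b l)%:E)%E /\
      (chi2 nx.-1 ny.-1 (F_le nx.-1 ny.-1 (stage_f t' t'' (alpha z) (beta z) nx ny / t''))
         <= (b l)%:E)%E.
Proof.
move=> t'0 t't'' [A [B [A0 B0 nA]]] [A' [B' [A'0 B'0 nB]]] ha hb eps0.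
have [rho [/andP[rho0 rho1] tails]] := F_tails_bound (separation_gt1 t'0 t't'').
(* For small [z] both [alpha z] and [beta z] lie between [a0 * z] and [b0 * z]. *)
pose a0 := Num.min A A'; pose b0 := Num.max B B'.
have a00 : 0 < a0 by rewrite lt_min A0.
have b00 : 0 < b0 by rewrite lt_max B0.
pose q := Num.sqrt a0; have q0 : 0 < q by rewrite sqrtr_gt0.
pose tau := Num.sqrt rho.
have tau0 : 0 < tau by rewrite sqrtr_gt0.
have tau1 : tau < 1 by rewrite -(@ltr_pXn2r _ 2)// ?nnegrE ?ltW// expr1n sqr_sqrtr// ltW.
(* The constant of [interpolated_bound], doubled because it is applied to [E = 2 * tau ^+ l.+1]. *)
pose C := (q + b0 / q) * 2.
have C0 : 0 < C by rewrite mulr_gt0// addr_gt0// divr_gt0.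
(* Below [z0], the bound [C * sqrt z / (1 - tau)] for the geometric sum is at most [eps]. *)
pose z0 := (eps * (1 - tau) / C) ^+ 2.
have e0 : 0 < eps * (1 - tau) / C by rewrite divr_gt0// mulr_gt0// subr_gt0.
have z00 : 0 < z0 by rewrite exprn_gt0.
near=> z.
have zgt0 : 0 < z by near: z; exact: nbhs_right_gt.
have zz0 : z < z0 by near: z; exact: nbhs_right_lt.
have /andP[Az zB] : A < alpha z / z < B by near: z.
have /andP[A'z zB'] : A' < beta z / z < B' by near: z.
pose w := Num.sqrt z.
have w0 : 0 < w by rewrite sqrtr_gt0.
have ww : w ^+ 2 = z by rewrite sqr_sqrtr// ltW.
exists (fun l => C * w * tau ^+ l.+1); split.
  move=> s; rewrite -mulr_sumr.
  apply: (@le_trans _ _ (C * w * (1 - tau)^-1)).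
    by rewrite (ler_pM2l (mulr_gt0 C0 w0)); apply: geometric_sum_le; rewrite tau0.
  rewrite ler_pdivrMr ?subr_gt0// mulrC -ler_pdivlMr//.
  by rewrite -(@ler_pXn2r _ 2)// ?nnegrE ?ltW// ww.
move=> l nx ny lx ly.
have ldx : (l.+1 <= nx.-1)%N by rewrite -ltnS prednK// (leq_trans _ lx).
have ldy : (l.+1 <= ny.-1)%N by rewrite -ltnS prednK// (leq_trans _ ly).
have nx1 : (1 < nx)%N by rewrite (leq_trans _ lx).
have ny1 : (1 < ny)%N by rewrite (leq_trans _ ly).
pose E := 2 * tau ^+ l.+1.
have E0 : 0 < E by rewrite mulr_gt0// exprn_gt0.
have EE : E ^+ 2 = 4 * rho ^+ l.+1.
  by rewrite exprMn -exprM mulnC exprM sqr_sqrtr ?ltW//; congr (_ * _); ring.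
have bE : C * w * tau ^+ l.+1 = (q + b0 / q) * w * E by rewrite /C /E; ring.
have he := tails l.+1 _ _ (ltn0Sn l) ldx ldy; rewrite -EE in he.
have [ga fb ge fe] := stage_tails_bound t'0 t't'' nx1 ny1 (ha z zgt0) (hb z zgt0) he.
(* Here the tail mass [E ^+ 2] falls below both levels, which activates the last two clauses of
   [stage_tails_bound]. *)
have small : E ^+ 2 <= (q * w) ^+ 2 -> E ^+ 2 < alpha z /\ E ^+ 2 < beta z.
  have -> : (q * w) ^+ 2 = a0 * z by rewrite exprMn ww sqr_sqrtr// ltW.
  move=> Ez.
  split; apply: (le_lt_trans Ez).
    apply: (@le_lt_trans _ _ (A * z)); first by rewrite ler_pM2r// ge_min lexx.
    by rewrite -ltr_pdivlMr.
  apply: (@le_lt_trans _ _ (A' * z)); first by rewrite ler_pM2r// ge_min lexx orbT.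
  by rewrite -ltr_pdivlMr.
have ab : alpha z <= b0 * w ^+ 2.
  rewrite ww -ler_pdivrMr//; apply: (le_trans (ltW zB)); by rewrite le_max lexx.
have bb : beta z <= b0 * w ^+ 2.
  rewrite ww -ler_pdivrMr//; apply: (le_trans (ltW zB')); by rewrite le_max lexx orbT.
have fin (S : set (measurableTypeR R * measurableTypeR R)) : measurable S ->
    chi2 nx.-1 ny.-1 S = (fine (chi2 nx.-1 ny.-1 S))%:E.
  pose chi : probability (measurableTypeR R * measurableTypeR R)%type R := chi2 nx.-1 ny.-1.
  by move=> mS; rewrite fineK//; exact: (@fin_num_measure _ _ _ chi).
have mg := measurable_F_gt nx.-1 ny.-1 (stage_g t' t'' (alpha z) (beta z) nx ny / t').
have mf := measurable_F_le nx.-1 ny.-1 (stage_f t' t'' (alpha z) (beta z) nx ny / t'').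
rewrite bE (fin _ mg) (fin _ mf) !lee_fin.
move: ga fb ge fe; rewrite (fin _ mg) (fin _ mf) !lee_fin => ga fb ge fe.
split; apply: interpolated_bound => //.
- exact: le_trans ga ab.
- by move=> /small[_ /ge].
- exact: le_trans fb bb.
- by move=> /small[/fe].
Unshelve. all: by end_near. Qed.
End Asymptotics.

(** * The decision rule *)

Section DecisionRule.
Context {R : realType}.

(** Threshold [k.+1] separates [i] from [j] and is the one next to [j]: number [j] when [i < j],
    number [j.+1] when [j < i]. *)
Lemma decision_rejects m (f g : nat -> R) (t : R) i j : (2 <= m)%N ->
  (i < m)%N -> (j < m)%N -> j <> i -> decision m f g t = j.+1 ->
  exists2 k, (k.+1 < m)%N & if (i < k.+1)%N then g k.+1 < t else t <= f k.+1.
Proof.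
move=> m2 im jm ji; rewrite /decision; case: ifPn => [tf [j0]|_].
  exists 0%N => //; rewrite ltnS leqn0; case: eqP => // i0; lia.
case: ifPn => [gt mj|_].
  exists m.-2; first by lia.
  have -> : m.-2.+1 = m.-1 by lia.
  by have -> : (i < m.-1)%N by lia.
set s := [seq _ <- _ | _] => hs.
(* The default 0 differs from [j.+1], so the list is nonempty and its head satisfies the filter. *)
have : head 0%N s \in s by case: (s) hs => //= a l _; rewrite mem_head.
rewrite hs mem_filter mem_index_iota => /andP[/andP[gj jf] /andP[j2 jm1]].
have [ij|ij] := ltnP i j.
  exists j.-1; first by lia.
  have -> : j.-1.+1 = j by lia.
  by rewrite ij.
exists j; first by lia.
by have -> : (i < j.+1)%N = false by lia.
Qed.

Context {d : measure_display} {T : measurableType d}.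

Lemma measurable_level_if (b : T -> bool) (F G : T -> nat) a :
  measurable [set w | b w] -> measurable [set w | F w = a] ->
  measurable [set w | G w = a] -> measurable [set w | (if b w then F w else G w) = a].
Proof.
move=> mb mF mG.
have -> : [set w | (if b w then F w else G w) = a] =
    ([set w | b w] `&` [set w | F w = a]) `|` (~` [set w | b w] `&` [set w | G w = a]).
  apply/seteqP; split => w /=; case: (b w) => /=.
  - by move=> Fa; left.
  - by move=> Ga; right.
  - by case=> [[]|[]].
  - by case=> [[]|[]].
by apply: measurableU; apply: measurableI => //; exact: measurableC.
Qed.

Lemma measurable_level_cst (c a : nat) : measurable [set _ : T | c = a].
Proof.
have [<-|ca] := eqVneq c a; first by rewrite (_ : [set _ | _] = setT)//; apply/seteqP.
by rewrite (_ : [set _ | _] = set0)//; apply/seteqP; split => // w /= /eqP; rewrite (negbTE ca).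
Qed.

Variables (h : T -> measurableTypeR R) (mh : measurable_fun setT h).

Lemma measurable_le_cst (c : R) : measurable [set w | h w <= c].
Proof.
rewrite -[X in measurable X]setTI.
have := measurable_fun_ler mh (measurable_cst c).
by move=> /(_ measurableT [set true]); exact.
Qed.

Lemma measurable_cst_lt (c : R) : measurable [set w | c < h w].
Proof.
rewrite -[X in measurable X]setTI.
have := measurable_fun_ltr (measurable_cst c) mh.
by move=> /(_ measurableT [set true]); exact.
Qed.

Lemma measurable_decision m (f g : nat -> R) a :
  measurable [set w | decision m f g (h w) = a].
Proof.
rewrite /decision; apply: measurable_level_if; first exact: measurable_le_cst.
  exact: measurable_level_cst.
apply: measurable_level_if; first exact: measurable_cst_lt.
  exact: measurable_level_cst.
elim: (index_iota 2 m) => [|x l IH] /=; first exact: measurable_level_cst.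
have -> : [set w | head 0%N (if (g x.-1 < h w) && (h w <= f x)
      then x :: [seq i <- l | (g i.-1 < h w) && (h w <= f i)]
      else [seq i <- l | (g i.-1 < h w) && (h w <= f i)]) = a] =
    [set w | (if (g x.-1 < h w) && (h w <= f x) then x
      else head 0%N [seq i <- l | (g i.-1 < h w) && (h w <= f i)]) = a].
  by apply/seteqP; split => w /=; case: ifP.
apply: measurable_level_if => //; last exact: measurable_level_cst.
have -> : [set w | (g x.-1 < h w) && (h w <= f x)] =
    [set w | g x.-1 < h w] `&` [set w | h w <= f x].
  by apply/seteqP; split => w /= /andP.
by apply: measurableI; [exact: measurable_cst_lt|exact: measurable_le_cst].
Qed.

End DecisionRule.

Lemma measurable_rejected {d : measure_display} {T : measurableType d}
    m s (Dl : T -> nat -> nat) i :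
  (forall l a, measurable [set w | Dl w l = a]) ->
  measurable [set w | rejected m s (Dl w) i].
Proof.
move=> mD.
have -> : [set w | rejected m s (Dl w) i] =
    \bigcup_(j in [set j | (j < m)%N /\ j <> i])
     \bigcup_(l in [set l | (1 <= l <= s)%N])
       ((\bigcap_(k in [set k | (1 <= k < l)%N]) [set w | Dl w k = 0%N]) `&`
        [set w | Dl w l = j.+1]).
  apply/seteqP; split => w /=.
    by move=> [j [jm ji [l [ls D0 Dj]]]]; exists j => //; exists l.
  by move=> [j [jm ji] [l ls [D0 Dj]]]; exists j; split => //; exists l; split.
apply: bigcup_measurable => j _; apply: bigcup_measurable => l _.
by apply: measurableI => //; apply: bigcap_measurableType => k _.
Qed.

(** * Union bound over thresholds and stages *)

Section Rejection.
Context {R : realType} {d : measure_display} {T : measurableType d}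
  (P : probability T R).

(* Rejecting [H_i] at stage [l] forces [theta_hat] across one of the thresholds
   separating [theta] from the accepted hypothesis. *)
Definition crossing (f g : nat -> nat -> R) (h : nat -> T -> R) i k l : set T :=
  [set w | if (i < k.+1)%N then g l.+1 k.+1 < h l.+1 w else h l.+1 w <= f l.+1 k.+1].

(** Rejection is contained in the union of all crossings over [m.-1] thresholds and [s] stages. Each
    threshold has the budget [eps / m] for all stages together. *)
Lemma rejected_le m s (f g : nat -> nat -> R) (h : nat -> T -> measurableTypeR R)
    i (b : nat -> nat -> R) (eps : R) : (2 <= m)%N -> (i < m)%N ->
  (forall l, measurable_fun setT (h l)) ->
  (forall k l, (k.+1 < m)%N -> (l < s)%N -> (P (crossing f g h i k l) <= (b k l)%:E)%E) ->
  (forall k, (k.+1 < m)%N -> \sum_(l < s) b k l <= eps / m%:R) -> 0 < eps ->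
  (P [set w | rejected m s (fun l => decision m (f l) (g l) (h l w)) i] <= eps%:E)%E.
Proof.
move=> m2 im mh Pb sb eps0.
have mcross k l : measurable (crossing f g h i k l).
  rewrite /crossing; case: (i < k.+1)%N; first exact: measurable_cst_lt.
  exact: measurable_le_cst.
have mstage k : measurable (\big[setU/set0]_(l < s) crossing f g h i k l).
  by apply: bigsetU_measurable => l _.
have sub : [set w | rejected m s (fun l => decision m (f l) (g l) (h l w)) i] `<=`
    \big[setU/set0]_(k < m.-1) \big[setU/set0]_(l < s) crossing f g h i k l.
  move=> w [j [jm ji [l [/andP[l1 ls] _ Dj]]]].
  have [k km hk] := decision_rejects m2 im jm ji Dj.
  rewrite -(bigcup_mkord _ (fun k => \big[setU/set0]_(l < s) crossing f g h i k l)).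
  exists k; first by rewrite /=; lia.
  rewrite -(bigcup_mkord _ (crossing f g h i k)).
  exists l.-1; first by rewrite /=; lia.
  by rewrite /crossing /= prednK.
apply: (le_trans (le_measure _ _ _ sub)); rewrite ?inE.
- by apply: measurable_rejected => l a; exact: measurable_decision.
- by apply: bigsetU_measurable => k _.
apply: (le_trans (Boole_inequality _ (fun k _ => mstage k))).
apply: (@le_trans _ _ (\sum_(k < m.-1) (eps / m%:R)%:E)%E).
  apply: lee_sum => k _; have km : (k.+1 < m)%N by have := ltn_ord k; lia.
  apply: (le_trans (Boole_inequality _ (fun l _ => mcross k l))).
  apply: (@le_trans _ _ (\sum_(l < s) (b k l)%:E)%E).
    by apply: lee_sum => l _; exact: Pb.
  by rewrite sumEFin lee_fin sb.
rewrite sumEFin lee_fin sumr_const card_ord -[leLHS]mulr_natr mulrAC ler_pdivrMr ?ltr0n; last by lia.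
by rewrite ler_pM2l// ler_nat leq_pred.
Qed.

End Rejection.

(** * Crossing probabilities in terms of the F-distribution *)

Section CrossingProbability.
Context {R : realType} {d : measure_display} {T : measurableType d}
  (P : probability T R) (X Y : nat -> {RV P >-> R}) (muX sigmaX muY sigmaY : R).
Hypotheses (sX0 : 0 < sigmaX) (sY0 : 0 < sigmaY).
Hypothesis samp : normal_samples muX sigmaX muY sigmaY X Y.
Local Notation th := (sigmaX ^+ 2 / sigmaY ^+ 2).
Local Notation that nx ny := (fun w => theta_hat (X^~ w) (Y^~ w) nx ny).

Lemma measurable_theta_hat nx ny :
  measurable_fun setT (that nx ny : T -> measurableTypeR R).
Proof.
have mS (Z : nat -> {RV P >-> R}) n :
    measurable_fun setT (fun w => sum_sq_dev (Z^~ w) n : measurableTypeR R).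
  by apply: measurable_sum_sq_dev => k _; exact: (measurable_funP (Z k)).
apply: measurable_funM; first by apply: measurable_funM => //; exact: mS.
apply: (measurableT_comp (@measurable_invr R)).
by apply: measurable_funM => //; exact: mS.
Qed.

Let th_gt0 : 0 < th. Proof. by rewrite divr_gt0// exprn_gt0. Qed.

Lemma F_ratio_sum_sq_dev_ge0 (x y : nat -> R) nx ny (a b : R) n k :
  0 <= F_ratio nx ny (sum_sq_dev x n / a ^+ 2, sum_sq_dev y k / b ^+ 2).
Proof. by rewrite /F_ratio /= !divr_ge0 ?sum_sq_dev_ge0 ?sqr_ge0. Qed.

Lemma measurable_sum_sq_dev_pair nx ny (C : set (measurableTypeR R * measurableTypeR R)) :
  measurable C ->
  measurable [set w | C (sum_sq_dev (X^~ w) nx / sigmaX ^+ 2,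
                         sum_sq_dev (Y^~ w) ny / sigmaY ^+ 2)].
Proof.
move=> mC.
have mS (Z : nat -> {RV P >-> R}) n (c : R) :
    measurable_fun setT (fun w => sum_sq_dev (Z^~ w) n / c : measurableTypeR R).
  apply: measurable_funM => //.
  by apply: measurable_sum_sq_dev => k _; exact: (measurable_funP (Z k)).
have := measurable_fun_pair (mS X nx (sigmaX ^+ 2)) (mS Y ny (sigmaY ^+ 2)).
by move=> /(_ measurableT C mC); rewrite setTI.
Qed.

(** The statistic is [th] times a nonnegative F-ratio, so replacing [th] by a larger [t] only
    enlarges the event: the end of the zone is the worst case. [theta_hat_le_le] is the mirror
    image. *)
Lemma theta_hat_gt_le nx ny (t g : R) : (1 < nx)%N -> (1 < ny)%N -> th <= t ->
  (P [set w | (g < that nx ny w)%R] <=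
   (chisq_prob nx.-1 \x chisq_prob ny.-1) (F_gt nx.-1 ny.-1 (g / t)))%E.
Proof.
case: nx ny => // nx [//|ny] _ _ tht /=.
have t0 : 0 < t by exact: lt_le_trans tht.
rewrite -(sum_sq_dev_pair_law sX0 sY0 samp); last exact: measurable_F_gt.
apply: le_measure; rewrite ?inE.
- exact: (measurable_cst_lt (measurable_theta_hat nx.+1 ny.+1)).
- by apply: measurable_sum_sq_dev_pair; exact: measurable_F_gt.
move=> w /=; rewrite (theta_hatE sX0 sY0) /F_gt /= => gw.
rewrite ltr_pdivrMr// [ltRHS]mulrC; apply: (lt_le_trans gw).
by apply: ler_wpM2r => //; exact: F_ratio_sum_sq_dev_ge0.
Qed.

Lemma theta_hat_le_le nx ny (t f : R) : (1 < nx)%N -> (1 < ny)%N -> 0 < t -> t <= th ->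
  (P [set w | (that nx ny w <= f)%R] <=
   (chisq_prob nx.-1 \x chisq_prob ny.-1) (F_le nx.-1 ny.-1 (f / t)))%E.
Proof.
case: nx ny => // nx [//|ny] _ _ t0 tth /=.
rewrite -(sum_sq_dev_pair_law sX0 sY0 samp); last exact: measurable_F_le.
apply: le_measure; rewrite ?inE.
- exact: (measurable_le_cst (measurable_theta_hat nx.+1 ny.+1)).
- by apply: measurable_sum_sq_dev_pair; exact: measurable_F_le.
move=> w /=; rewrite (theta_hatE sX0 sY0) /F_le /= => wf.
rewrite ler_pdivlMr// mulrC; apply: le_trans wf.
by apply: ler_wpM2r => //; exact: F_ratio_sum_sq_dev_ge0.
Qed.

End CrossingProbability.

(** Strict growth from at least 2 yields at least as many degrees of freedom as the stage number,
    which makes the tail bound geometric in the stage. *)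
Lemma lt_stage_size (n : nat -> nat) (s : nat) : (2 <= n 1)%N ->
  (forall l, (1 <= l < s)%N -> (n l < n l.+1)%N) ->
  forall l, (l < s)%N -> (l.+1 < n l.+1)%N.
Proof.
move=> n1 nS; elim=> [|l IH] ls; first exact: n1.
by apply: (leq_ltn_trans (IH (ltnW ls))); apply: nS.
Qed.

(** * Position of the zones relative to the thresholds *)

Section Zones.
Context {R : realType} (m : nat) (theta' theta'' : nat -> R).
Hypothesis (hlt : forall i, (1 <= i < m)%N -> 0 < theta' i < theta'' i).
Hypothesis (hsep : forall i, (1 <= i)%N -> (i.+1 < m)%N -> theta'' i <= theta' i.+1).

Let theta'_lt j : (j.+2 < m)%N -> theta' j.+1 <= theta' j.+2.
Proof.
move=> jm; apply: (@le_trans _ _ (theta'' j.+1)); last exact: hsep.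
by have /andP[_ /ltW] := @hlt j.+1 ltac:(lia).
Qed.

Let theta''_lt j : (j.+2 < m)%N -> theta'' j.+1 <= theta'' j.+2.
Proof.
move=> jm; apply: (@le_trans _ _ (theta' j.+2)); first exact: hsep.
by have /andP[_ /ltW] := @hlt j.+2 ltac:(lia).
Qed.

Let theta'_mono i j : (i <= j)%N -> (j.+1 < m)%N -> theta' i.+1 <= theta' j.+1.
Proof.
elim: j => [|j IH]; first by rewrite leqn0 => /eqP ->.
rewrite leq_eqVlt => /orP[/eqP -> //|ij] jm.
by apply: (le_trans (IH _ _) (theta'_lt jm)); lia.
Qed.

Let theta''_mono i j : (i <= j)%N -> (j.+1 < m)%N -> theta'' i.+1 <= theta'' j.+1.
Proof.
elim: j => [|j IH]; first by rewrite leqn0 => /eqP ->.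
rewrite leq_eqVlt => /orP[/eqP -> //|ij] jm.
by apply: (le_trans (IH _ _) (theta''_lt jm)); lia.
Qed.

Lemma zone_le_above i k (t : R) : (i < m)%N -> zone theta' theta'' m i t ->
  (i <= k)%N -> (k.+1 < m)%N -> t <= theta' k.+1.
Proof.
move=> im zt ik km; apply: (@le_trans _ _ (theta' i.+1)); last exact: theta'_mono.
move: zt; rewrite /zone; case: eqP => [->|_]; first by rewrite /= in_itv/= => /andP[].
by case: eqP => [|_]; [lia|rewrite /= in_itv/= => /andP[]].
Qed.

Lemma zone_ge_below i k (t : R) : (i < m)%N -> zone theta' theta'' m i t ->
  (k < i)%N -> theta'' k.+1 <= t.
Proof.
case: i => // i im zt; rewrite ltnS => ki.
apply: (@le_trans _ _ (theta'' i.+1)); first exact: theta''_mono.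
by move: zt; rewrite /zone /=; case: eqP => _; rewrite /= in_itv/= => /andP[].
Qed.

End Zones.

(** * Error control for every hypothesis when zeta is small *)

Theorem theorem11 (R : realType) (m : nat) (hm : (2 <= m)%N)
  (theta theta' theta'' : nat -> R)
  (htheta1 : 0 < theta 1%N)
  (htheta : forall i, (1 <= i)%N -> (i.+1 < m)%N -> theta i < theta i.+1)
  (hindiff : forall i, (1 <= i < m)%N ->
     [/\ 0 < theta' i, theta' i < theta i & theta i < theta'' i])
  (hsep : forall i, (1 <= i)%N -> (i.+1 < m)%N -> theta'' i <= theta' i.+1)
  (delta : nat -> R) (hdelta : forall i, (i < m)%N -> 0 < delta i < 1)
  (alpha beta : nat -> R -> R)
  (halphaO : forall i, (1 <= i < m)%N -> order_zeta (alpha i))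
  (hbetaO : forall i, (1 <= i < m)%N -> order_zeta (beta i))
  (halpha : forall i zeta, (1 <= i < m)%N -> 0 < zeta -> 0 < alpha i zeta < 1)
  (hbeta : forall i zeta, (1 <= i < m)%N -> 0 < zeta -> 0 < beta i zeta < 1)
  (s : R -> nat) (nX nY : R -> nat -> nat)
  (hs : forall zeta, 0 < zeta -> (1 <= s zeta)%N)
  (hnX1 : forall zeta, 0 < zeta -> (2 <= nX zeta 1)%N)
  (hnY1 : forall zeta, 0 < zeta -> (2 <= nY zeta 1)%N)
  (hnX : forall zeta l, 0 < zeta -> (1 <= l < s zeta)%N ->
     (nX zeta l < nX zeta l.+1)%N)
  (hnY : forall zeta l, 0 < zeta -> (1 <= l < s zeta)%N ->
     (nY zeta l < nY zeta l.+1)%N)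
  (hmax : forall zeta i, 0 < zeta -> (1 <= i < m)%N ->
     theta' i * u_bound (nX zeta (s zeta)) (nY zeta (s zeta)) (alpha i zeta) <=
     theta'' i * v_bound (nX zeta (s zeta)) (nY zeta (s zeta)) (beta i zeta)) :
  \forall zeta \near 0^'+,
    forall (i : nat) (th : R), (i < m)%N -> zone theta' theta'' m i th ->
    forall muX muY sigmaX sigmaY : R, 0 < sigmaX -> 0 < sigmaY ->
    th = sigmaX ^+ 2 / sigmaY ^+ 2 ->
    forall (d : measure_display) (T : measurableType d) (P : probability T R)
      (X Y : nat -> {RV P >-> R}),
    normal_samples muX sigmaX muY sigmaY X Y ->
    (P [set w | rejected m (s zeta)
                  (D theta' theta'' (alpha^~ zeta) (beta^~ zeta) m
                     (nX zeta) (nY zeta) (X^~ w) (Y^~ w)) i]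
     <= (delta i)%:E)%E.
Proof.
have mgt0 : 0 < m%:R :> R by rewrite ltr0n; lia.
pose bounds zeta i k (b : nat -> R) :=
  (forall s, \sum_(l < s) b l <= delta i / m%:R) /\
  forall l nx ny, (l.+1 < nx)%N -> (l.+1 < ny)%N ->
    ((chisq_prob nx.-1 \x chisq_prob ny.-1)%E (F_gt nx.-1 ny.-1
       (stage_g (theta' k) (theta'' k) (alpha k zeta) (beta k zeta) nx ny / theta' k))
       <= (b l)%:E)%E /\
    ((chisq_prob nx.-1 \x chisq_prob ny.-1)%E (F_le nx.-1 ny.-1
       (stage_f (theta' k) (theta'' k) (alpha k zeta) (beta k zeta) nx ny / theta'' k))
       <= (b l)%:E)%E.
(* Finitely many pairs of hypothesis and threshold, so the neighbourhoods of 0 intersect to one. It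
   is fixed before the parameters and the probability space are introduced and serves all of
   them. *)
have near_bounds : \forall zeta \near 0^'+,
    forall (i : 'I_m) (k : 'I_m.-1), exists b, bounds zeta i k.+1 b.
  apply: filter_forall => i; apply: filter_forall => k.
  have km : (1 <= k.+1 < m)%N by have := ltn_ord k; lia.
  have [t'0 tt' tt''] := hindiff k.+1 km.
  apply: zeta_stage_bound => //.
  - exact: lt_trans tt' tt''.
  - exact: halphaO.
  - exact: hbetaO.
  - by move=> z; apply: halpha.
  - by move=> z; apply: hbeta.
  - by rewrite divr_gt0//; have /andP[] := hdelta i (ltn_ord i).
near=> zeta.
have z0 : 0 < zeta by near: zeta; exact: nbhs_right_gt.
have zeta_bounds : forall (i : 'I_m) (k : 'I_m.-1), exists b, bounds zeta i k.+1 b.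
  by near: zeta.
move=> i th im zth muX muY sigmaX sigmaY sX0 sY0 thE d T P X Y samp.
(* Indices outside the range of thresholds receive the zero sequence, for which nothing is
   claimed. *)
have /choice[b Hb] k : exists b : nat -> R, (k.+1 < m)%N -> bounds zeta i k.+1 b.
  have [km|km] := ltnP k.+1 m; last by exists (fun=> 0).
  have km' : (k < m.-1)%N by lia.
  by have [b hb] := zeta_bounds (Ordinal im) (Ordinal km'); exists b.
have hlt k : (1 <= k < m)%N -> 0 < theta' k < theta'' k.
  by move=> /hindiff[t0 t1 t2]; rewrite t0 (lt_trans t1).
apply: (rejected_le (b := b)
  (f := fun l => f_bound theta' theta'' (alpha^~ zeta) (beta^~ zeta) (nX zeta l) (nY zeta l))
  (g := fun l => g_bound theta' theta'' (alpha^~ zeta) (beta^~ zeta) (nX zeta l) (nY zeta l))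
  (h := fun l w => theta_hat (X^~ w) (Y^~ w) (nX zeta l) (nY zeta l))) => //.
- by move=> l; exact: measurable_theta_hat.
- move=> k l km ls.
  have lx := lt_stage_size (hnX1 zeta z0) (fun l => hnX zeta l z0) ls.
  have ly := lt_stage_size (hnY1 zeta z0) (fun l => hnY zeta l z0) ls.
  have x1 : (1 < nX zeta l.+1)%N by apply: leq_ltn_trans lx.
  have y1 : (1 < nY zeta l.+1)%N by apply: leq_ltn_trans ly.
  have [_ /(_ l _ _ lx ly)[bg bf]] := Hb k km.
  (* A threshold above the zone of [th] has [th <= theta' k.+1], one below it has
     [theta'' k.+1 <= th]; these ends are the divisors in the bounds on [g] and [f]. *)
  rewrite /crossing; have [ik|ki] := boolP (i < k.+1)%N.
    apply: le_trans bg; apply: (theta_hat_gt_le sX0 sY0 samp) => //.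
    by rewrite -thE; apply: (zone_le_above hlt hsep im zth).
  apply: le_trans bf; apply: (theta_hat_le_le sX0 sY0 samp) => //.
    by have /andP[t0 t1] := hlt k.+1 ltac:(lia); exact: lt_trans t1.
  by rewrite -thE; apply: (zone_ge_below hlt hsep im zth); lia.
- by move=> k km; have [] := Hb k km.
- by have /andP[] := hdelta i im.
Unshelve. all: by end_near. Qed.
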